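(* Let $n\geq 3$ and let $T,T'\in\mathcal{T}_n$ be two trees on $n$ vertices. If $T<T'$ in the Csikvári poset on $\mathcal{T}_n$, then $f(T')\leq f(T)$ coefficientwise in $\mathbb{Z}[y]$, i.e. all coefficients of the polynomial $f(T)-f(T')$ are non-negative.
   Context: **Graphs and Tutte polynomial.** A graph is a finite undirected graph, possibly with parallel edges and loops. The Tutte polynomial $\mathbf{T}_G(x,y)\in\mathbb{Z}[x,y]$ of a graph $G$ is defined recursively by: $\mathbf{T}_G=1$ if $G$ has no edges; and for an edge $e$ of $G$, $\mathbf{T}_G=\mathbf{T}_{G\setminus e}+\mathbf{T}_{G/e}$ if $e$ is neither a loop nor a bridge, $\mathbf{T}_G=y\,\mathbf{T}_{G\setminus e}$ if $e$ is a loop, $\mathbf{T}_G=x\,\mathbf{T}_{G/e}$ if $e$ is a bridge. Here $G\setminus e$ and $G/e$ denote deletion and contraction of $e$ (contraction keeps any resulting parallel edges and loops). **Cone and $f$.** The cone $\mathrm{Cone}(G)$ over a graph $G$ is obtained from $G$ by adding one extra vertex $r$ and connecting $r$ to each vertex of $G$ by one edge. Define $f(G):=\mathbf{T}_{\mathrm{Cone}(G)}(1,y)\in\mathbb{Z}[y]$. **Trees.** $\mathcal{T}_n$ denotes the set of all trees on $n$ vertices, considered up to isomorphism. **1-sum.** If $G_1,G_2$ are graphs with distinguished vertices $w_1,w_2$ respectively, $G_1:G_2$ is the graph obtained from the disjoint union of $G_1$ and $G_2$ by identifying $w_1$ with $w_2$. **Generalized tree shift.** Let $P_k$ be a path in a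 tree $T$ with vertex sequence $v_1,v_2,\dots,v_k$ ($k\geq 2$) such that all interior vertices $v_2,\dots,v_{k-1}$ have degree two in $T$ (no interior vertex when $k=2$). Removing all edges and interior vertices of $P_k$ from $T$ leaves a tree $H_1$ with distinguished vertex $v_1$ and a tree $H_2$ with distinguished vertex $v_k$. The generalized tree shift with respect to $P_k$ transforms $T$ into the tree $T':=(H_1:H_2):P_k$, where first $v_1\in H_1$ is identified with $v_k\in H_2$, and then this identified vertex of $H_1:H_2$ is identified with the end vertex $v_k$ of the path $P_k$. **Csikvári poset.** For $T,T'\in\mathcal{T}_n$, write $T\leq T'$ if $T'$ can be obtained from $T$ by a finite (possibly empty) sequence of generalized tree shifts. This is a partial order on $\mathcal{T}_n$, called the Csikvári poset. $T<T'$ means $T\leq T'$ and $T\neq T'$ (i.e. $T,T'$ not isomorphic). *)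

(* Defs.v *)
From HB Require Import structures.
From mathcomp Require Import all_boot all_order all_algebra.

Set Implicit Arguments.
Unset Strict Implicit.
Unset Printing Implicit Defensive.

Import Order.TTheory GRing.Theory Num.Theory.

(* Finite undirected multigraphs.  The edge multiset is a list of pairs of
   ends: repeated entries are parallel edges, (a, a) is a loop, and the order
   inside a pair carries no meaning, so (a, b) and (b, a) are parallel. *)
Record mgraph := MGraph {
  vert :> finType;
  edges : seq (vert * vert)
}.

Definition joins (V : eqType) (a b : V) : pred (V * V) :=
  [pred e | (e == (a, b)) || (e == (b, a))].

Definition mult (G : mgraph) (a b : G) : nat := count (joins a b) (edges G).

Definition adj (G : mgraph) : rel G := [rel a b | has (joins a b) (edges G)].

(* A loop contributes 2. *)
Definition degree (G : mgraph) (a : G) : nat :=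
  \sum_(e <- edges G) ((e.1 == a) + (e.2 == a)).

Definition iso (G H : mgraph) : Prop :=
  exists2 f : G -> H, bijective f & forall a b, mult (f a) (f b) = mult a b.

(* Identification of v with u.  The representatives are the vertices other
   than v, with u kept when u = v, in which case nothing is identified. *)
Definition ident_vert (V : finType) (u v : V) : finType :=
  {x : V | (x != v) || (x == u)}.

Lemma ident_subproof (V : finType) (u v x : V) :
  let y := if x == v then u else x in (y != v) || (y == u).
Proof. by rewrite /=; case: (eqVneq x v) => [_|->] //; rewrite eqxx orbT. Qed.

Definition ident_map (V : finType) (u v x : V) : ident_vert u v :=
  exist _ (if x == v then u else x) (ident_subproof u v x).

Definition identify (G : mgraph) (u v : G) : mgraph :=
  @MGraph (ident_vert u v)
    [seq (ident_map u v e.1, ident_map u v e.2) | e <- edges G].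

Definition delete_edge (G : mgraph) (e : G * G) : mgraph :=
  @MGraph G (rem e (edges G)).

Definition contract_edge (G : mgraph) (e : G * G) : mgraph :=
  @identify (delete_edge e) e.1 e.2.

Definition is_loop (G : mgraph) (e : G * G) : bool := e.1 == e.2.

Definition is_bridge (G : mgraph) (e : G * G) : bool :=
  ~~ connect (@adj (delete_edge e)) e.1 e.2.

Local Open Scope ring_scope.

(* T_G(x, y) lives in Z[y][x]: 'X is x and 'X%:P is y.  The recursion is run on
   the first edge of the list (by the classical theorem that the Tutte
   polynomial is well defined, the choice of the edge does not matter); the
   counter m only ensures termination and is started at the number of edges. *)
Fixpoint tutte_rec (m : nat) (G : mgraph) : {poly {poly int}} :=
  match m, edges G with
  | m'.+1, e :: _ =>
      if is_loop e then ('X%:P) * tutte_rec m' (delete_edge e)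
      else if is_bridge e then 'X * tutte_rec m' (contract_edge e)
      else tutte_rec m' (delete_edge e) + tutte_rec m' (contract_edge e)
  | _, _ => 1
  end.

Definition tutte (G : mgraph) : {poly {poly int}} :=
  tutte_rec (size (edges G)) G.

(* The apex is None. *)
Definition cone (G : mgraph) : mgraph :=
  @MGraph (option G)
    ([seq (None, Some a) | a <- enum G] ++
     [seq (Some e.1, Some e.2) | e <- edges G]).

Definition f_poly (G : mgraph) : {poly int} := (tutte (cone G)).[1].

Local Close Scope ring_scope.

Definition simple_graph (G : mgraph) : Prop :=
  (forall a : G, mult a a = 0) /\ (forall a b : G, mult a b <= 1).

Definition connected (G : mgraph) : Prop :=
  0 < #|G| /\ forall a b : G, connect (@adj G) a b.

Definition is_tree (G : mgraph) : Prop :=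
  [/\ simple_graph G, connected G &
      forall c : seq G, 2 < size c -> ~ ucycle (@adj G) c].

Definition disjoint_union (G1 G2 : mgraph) : mgraph :=
  @MGraph (G1 + G2)%type
    ([seq (inl e.1, inl e.2) | e <- edges G1] ++
     [seq (inr e.1, inr e.2) | e <- edges G2]).

Definition one_sum (G1 : mgraph) (w1 : G1) (G2 : mgraph) (w2 : G2) : mgraph :=
  @identify (disjoint_union G1 G2) (inl w1) (inr w2).

Definition one_sum_root (G1 : mgraph) (w1 : G1) (G2 : mgraph) (w2 : G2) :
    one_sum w1 w2 :=
  ident_map (inl w1) (inr w2) (inl w1).

(* The path with m.+1 vertices 0, ..., m. *)
Definition path_graph (m : nat) : mgraph :=
  @MGraph 'I_m.+1 [seq (inord i, inord i.+1) | i <- iota 0 m].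

Definition comp_vert (G : mgraph) (v : G) : finType :=
  {x : G | connect (@adj G) v x}.

Definition component (G : mgraph) (v : G) : mgraph :=
  @MGraph (comp_vert v)
    (pmap (fun e : G * G =>
             if (insub e.1, insub e.2) is (Some a, Some b) then Some (a, b)
             else None)
          (edges G)).

Definition component_root (G : mgraph) (v : G) : component v :=
  exist _ v (connect0 (@adj G) v).

(* T with all edges of the path v1, mid, vk and all edges at its interior
   vertices mid removed.  The interior vertices are left isolated instead of
   being dropped; they disappear on passing to the components of v1 and vk. *)
Definition remove_path (T : mgraph) (v1 : T) (mid : seq T) (vk : T) : mgraph :=
  let p := v1 :: rcons mid vk in
  let on_path (e : T * T) :=
    has (fun d : T * T => joins d.1 d.2 e) (zip p (behead p)) in
  @MGraph T
    [seq e <- edges T | [&& ~~ on_path e, e.1 \notin mid & e.2 \notin mid]].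

Section TreeShift.
Variables (T : mgraph) (v1 : T) (mid : seq T) (vk : T).

Definition shift_path : Prop :=
  [/\ path (@adj T) v1 (rcons mid vk), uniq (v1 :: rcons mid vk) &
      {in mid, forall v, degree v = 2}].

Let R := remove_path v1 mid vk.

(* (H1 : H2) : P_k with k = size mid + 2; the end v_k of P_k is ord_max. *)
Definition shift_graph : mgraph :=
  let w1 := @component_root R v1 in
  let w2 := @component_root R vk in
  one_sum (one_sum_root w1 w2) (ord_max : path_graph (size mid).+1).

End TreeShift.

Definition tree_shift (T T' : mgraph) : Prop :=
  is_tree T /\
  exists (v1 : T) (mid : seq T) (vk : T),
    shift_path v1 mid vk /\ iso T' (shift_graph v1 mid vk).

(* Trees are taken up to isomorphism, so the empty sequence of shifts relates
   any two isomorphic trees. *)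
Inductive csikvari_le : mgraph -> mgraph -> Prop :=
| csikvari_refl T T' : iso T T' -> csikvari_le T T'
| csikvari_step T S T' :
    tree_shift T S -> csikvari_le S T' -> csikvari_le T T'.

Definition csikvari_lt (T T' : mgraph) : Prop :=
  csikvari_le T T' /\ ~ iso T T'.

(* Main.v *)
Require Import Defs.
From mathcomp Require Import all_boot all_order all_algebra.
From mathcomp Require Import perm.
From mathcomp Require Import ring.
Import Order.TTheory GRing.Theory Num.Theory.
Local Open Scope ring_scope.
Set Implicit Arguments.
Unset Strict Implicit.
Unset Printing Implicit Defensive.

(** For a connected graph G with n vertices, the Tutte polynomial at x = 1 is
    the coefficient of t ^ (n - 1), the largest possible power of t, in the
    rank polynomial
      Z_G(t, y) = sum over the edge sets A of t ^ r(A) (y - 1) ^ (|A| - r(A)),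
    where r is the graphic rank.  Z is computed by deletion and contraction
    without any distinction of bridges ([rank_cons]), it depends on the edges
    only ([rank_same]), and it has non-negative coefficients ([rank_nneg]).
    The link with the Tutte recursion is [tutte_rec_rank].

    Take a piece H of a graph that meets the rest X of the graph in two
    vertices r and w only.  Sorting the sets of edges of H by whether they
    connect r to w gives polynomials A (not connected) and B (connected) with
      Z(H + X) = A Z(X) + B Z(X / rw)
    for every X ([rank_glue2]); A and B have non-negative coefficients and
    bounded degree in t.

    Let v_1, ..., v_k be the path of a shift from T to T', and let r be the
    apex of the cone.  The cone over T consists of a piece H_1 at {r, v_1}, a
    piece H_2 at {r, v_k}, and the fan F formed by the path and its spokes;
    the cone over T' differs only in that H_2 is attached at {r, v_1}.
    Expanding both by the formula above, the terms where H_1 or H_2 does not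
    connect its two ends cancel, the latter because the fan is symmetric
    under reversal of the path ([rank_fan_sym]).  What remains is
      t (Z_T - Z_T') = (t - (y - 1)) B_1 B_2 A,
    where A is the coefficient of F / r v_k that does not connect r to v_1
    ([rank_shift]).  In the highest power of t only t B_1 B_2 A survives,
    by the degree bounds, and its coefficients are non-negative.

    That the cones have this shape is where the tree is used: without the
    edges of the path, v_1 and v_k lie in different components, which together
    with the interior of the path cover all vertices ([remove_path_separates],
    [remove_path_cover]). *)

(** * The rank polynomial *)

Definition relabel (V W : Type) (h : V -> W) (E : seq (V * V)) : seq (W * W) :=
  [seq (h e.1, h e.2) | e <- E].
Arguments relabel : simpl never.

Definition collapse (V : eqType) (u v x : V) : V := if x == v then u else x.

Definition ends (V : Type) (E : seq (V * V)) : seq V :=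
  flatten [seq [:: e.1; e.2] | e <- E].

(** In Z[y][t], where the rank polynomial lives, 'X is t and yvar is y. *)
Definition yvar : {poly {poly int}} := 'X%:P.

(** Contraction is a change of vertex labels: contracted vertices get the same
    label, so that the recursion is structural in the list of edges.  The
    factor t counts the contracted edges that are not loops, whence the
    exponent of t is the rank of the set of contracted edges. *)
Fixpoint rank_lab (V W : eqType) (g : V -> W) (E : seq (V * V)) :
    {poly {poly int}} :=
  if E is e :: E' then
    if g e.1 == g e.2 then yvar * rank_lab g E'
    else rank_lab g E' + 'X * rank_lab (collapse (g e.1) (g e.2) \o g) E'
  else 1.

Definition rank_poly (V : eqType) (E : seq (V * V)) := rank_lab id E.

Lemma relabel_cat (V W : Type) (h : V -> W) E1 E2 :
  relabel h (E1 ++ E2) = relabel h E1 ++ relabel h E2.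
Proof. exact: map_cat. Qed.

Lemma relabel_cons (V W : Type) (h : V -> W) a b E :
  relabel h ((a, b) :: E) = (h a, h b) :: relabel h E.
Proof. by []. Qed.

Lemma relabel_comp (U V W : Type) (h : V -> W) (k : U -> V) E :
  relabel h (relabel k E) = relabel (h \o k) E.
Proof. by rewrite /relabel -map_comp. Qed.

Lemma ends_cat (V : Type) (E1 E2 : seq (V * V)) :
  ends (E1 ++ E2) = ends E1 ++ ends E2.
Proof. by rewrite /ends map_cat flatten_cat. Qed.

Lemma ends_relabel (V W : Type) (h : V -> W) E :
  ends (relabel h E) = map h (ends E).
Proof. by elim: E => //= e E; rewrite /ends /= => ->. Qed.

Lemma mem_ends (V : eqType) (E : seq (V * V)) e :
  e \in E -> (e.1 \in ends E) && (e.2 \in ends E).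
Proof.
elim: E => //= f E IH; rewrite !inE; case/predU1P => [->|/IH /andP[-> ->]].
  by rewrite !eqxx !orbT.
by rewrite !orbT.
Qed.

Lemma eq_in_relabel (V : eqType) (W : Type) (h k : V -> W) (E : seq (V * V)) :
  {in ends E, h =1 k} -> relabel h E = relabel k E.
Proof.
move=> hk; apply/eq_in_map => e /mem_ends /andP[e1 e2] /=.
by rewrite !hk.
Qed.

Lemma relabel_id_in (V : eqType) (h : V -> V) (E : seq (V * V)) :
  {in ends E, h =1 id} -> relabel h E = E.
Proof.
by move=> hk; rewrite (eq_in_relabel hk) /relabel -[RHS]map_id; apply: eq_map;
  case.
Qed.

Lemma collapse_eq (V : eqType) (a b x y : V) :
  (collapse a b x == collapse a b y) =
  (x == y) || ((x == a) || (x == b)) && ((y == a) || (y == b)).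
Proof.
rewrite /collapse; do !case: eqP => //=; congruence.
Qed.

(** Only the partition of the vertices into classes of equal label matters. *)
Lemma eq_rank_lab (V W1 W2 : eqType) (g1 : V -> W1) (g2 : V -> W2) E :
  {in ends E &, forall x y, (g1 x == g1 y) = (g2 x == g2 y)} ->
  rank_lab g1 E = rank_lab g2 E.
Proof.
elim: E g1 g2 => //= -[a b] E IH g1 g2 /= ker.
have sub x : x \in ends E -> x \in ends ((a, b) :: E).
  by rewrite !inE => ->; rewrite !orbT.
have [a_in b_in] : a \in ends ((a, b) :: E) /\ b \in ends ((a, b) :: E).
  by rewrite !inE !eqxx !orbT.
rewrite ker // (IH _ g2) => [|x y /sub xE /sub yE]; last exact: ker;
  case: ifP => // _.
congr (_ + 'X * _); apply: IH => x y /sub xE /sub yE /=; rewrite !collapse_eq.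
by rewrite !ker.
Qed.

Lemma rank_lab_relabel (U V W : eqType) (g : V -> W) (h : U -> V) E :
  rank_lab g (relabel h E) = rank_lab (g \o h) E.
Proof. by elim: E g => //= e E IH g; rewrite !IH. Qed.

Lemma rank_labE (V W : eqType) (g : V -> W) E :
  rank_lab g E = rank_poly (relabel g E).
Proof. by rewrite /rank_poly rank_lab_relabel. Qed.

Lemma rank_cons (V : eqType) (a b : V) E :
  rank_poly ((a, b) :: E) =
  if a == b then yvar * rank_poly E
  else rank_poly E + 'X * rank_poly (relabel (collapse a b) E).
Proof. by rewrite -rank_labE /rank_poly. Qed.

Lemma rank_ker (U V W : eqType) (g : U -> V) (h : U -> W) E :
  {in ends E &, forall x y, (g x == g y) = (h x == h y)} ->
  rank_poly (relabel g E) = rank_poly (relabel h E).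
Proof. by rewrite -!rank_labE; exact: eq_rank_lab. Qed.

Lemma rank_inj (V W : eqType) (h : V -> W) E :
  injective h -> rank_poly (relabel h E) = rank_poly E.
Proof.
move=> h_inj; rewrite -rank_labE; apply: eq_rank_lab => x y _ _ /=.
exact: inj_eq.
Qed.

Lemma rank_flip (V : eqType) (a b : V) E :
  rank_poly ((a, b) :: E) = rank_poly ((b, a) :: E).
Proof.
rewrite !rank_cons [b == a]eq_sym; case: ifP => // _; congr (_ + 'X * _).
by apply: rank_ker => x y _ _; rewrite !collapse_eq ![(_ == a) || _]orbC.
Qed.

(** If e and f are parallel or neither becomes a loop, the four terms match
    because contracting e then f or f then e identifies the same vertices,
    up to the choice of representatives. *)
Lemma rank_swap (V : eqType) (e f : V * V) E :
  rank_poly [:: e, f & E] = rank_poly [:: f, e & E].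
Proof.
case: e f => [a b] [c d].
rewrite (rank_cons a b) (rank_cons c d (_ :: _)) !relabel_cons.
rewrite (rank_cons a b E) (rank_cons c d E).
rewrite (rank_cons (collapse a b c)) (rank_cons (collapse c d a)) !collapse_eq.
have [ab|ab] := eqVneq a b; have [cd|cd] := eqVneq c d => //=.
- by ring.
- by ring.
have -> : ((a == c) || (a == d)) && ((b == c) || (b == d)) =
          ((c == a) || (c == b)) && ((d == a) || (d == b)).
  by move: ab cd; do !case: eqP => //; congruence.
case: ifP => [abcd|nabcd].
  have -> : rank_poly (relabel (collapse a b) E) = rank_poly (relabel (collapse
    c d) E).
    apply: rank_ker => x y _ _; rewrite !collapse_eq.
    have eq_pair z : (z == a) || (z == b) = (z == c) || (z == d).
      by move: abcd ab cd; do !case: eqP => //; congruence.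
    by rewrite !eq_pair.
  by rewrite -!addrA mulrCA.
rewrite !mulrDr -!addrA; congr (_ + _); rewrite addrCA;
  congr (_ + (_ + 'X * ('X * _))).
rewrite !relabel_comp; apply: rank_ker => x y _ _ /=.
rewrite !collapse_eq.
move: ab cd nabcd; clear.
by do ![case: eqP => //=]; congruence.
Qed.

Lemma rank_middle (V : eqType) (E1 : seq (V * V)) e E2 :
  rank_poly (E1 ++ e :: E2) = rank_poly (e :: E1 ++ E2).
Proof.
have [m] := ubnP (size E1);
  elim: m E1 e E2 => // m IH [|[a b] E1] // [c d] E2 lt_m.
rewrite cat_cons rank_swap !(rank_cons a b) relabel_cat !relabel_cons
  relabel_cat.
by rewrite !IH ?size_map.
Qed.

(** The unordered edge underlying a pair. *)
Definition und (V : finType) (e : V * V) : {set V} := [set e.1; e.2].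

Lemma und_pairP (V : finType) (a b : V) (e : V * V) :
  und e = und (a, b) -> e = (a, b) \/ e = (b, a).
Proof.
case: e => [c d]; rewrite /und /= => /setP eq_e.
have := eq_e a; have := eq_e b; have := eq_e c; have := eq_e d.
rewrite !inE !eqxx ?orbT.
by do !case: eqP => //=; intuition congruence.
Qed.

Lemma map_und_relabel (V W : finType) (h : V -> W) (E : seq (V * V)) :
  map (@und W) (relabel h E) = map (fun A : {set V} => h @: A) (map (@und V) E).
Proof.
rewrite -!map_comp; apply: eq_map => e /=; rewrite /und /=.
by rewrite imsetU !imset_set1.
Qed.

Definition same_edges (V : finType) (E E' : seq (V * V)) : bool :=
  perm_eq (map (@und V) E) (map (@und V) E').

Lemma same_refl (V : finType) (E : seq (V * V)) : same_edges E E.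
Proof. exact: perm_refl. Qed.

Lemma same_sym (V : finType) (E E' : seq (V * V)) :
  same_edges E E' = same_edges E' E.
Proof. exact: perm_sym. Qed.

Lemma same_trans (V : finType) (E2 E1 E3 : seq (V * V)) :
  same_edges E1 E2 -> same_edges E2 E3 -> same_edges E1 E3.
Proof. exact: perm_trans. Qed.

Lemma same_cat (V : finType) (E1 E2 F1 F2 : seq (V * V)) :
  same_edges E1 F1 -> same_edges E2 F2 -> same_edges (E1 ++ E2) (F1 ++ F2).
Proof. by rewrite /same_edges !map_cat; apply: perm_cat. Qed.

Lemma perm_same (V : finType) (E E' : seq (V * V)) :
  perm_eq E E' -> same_edges E E'.
Proof. exact: perm_map. Qed.

Lemma same_relabel (V W : finType) (h : V -> W) (E E' : seq (V * V)) :
  same_edges E E' -> same_edges (relabel h E) (relabel h E').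
Proof. by rewrite /same_edges !map_und_relabel; apply: perm_map. Qed.

(** Matching edges are moved to the front one by one; flipping an edge or
    changing the order does not affect the recursion. *)
Lemma rank_same (V : finType) (E E' : seq (V * V)) :
  same_edges E E' -> rank_poly E = rank_poly E'.
Proof.
have [m] := ubnP (size E); elim: m E E' => // m IH [|[a b] E] E' lt_m EE'.
  by move: (perm_size EE') => /=; case: E' {EE'}.
have /mapP[e e_in e_ab]: und (a, b) \in map (@und V) E'.
  by rewrite -(perm_mem EE') mem_head.
case/splitPr: e_in EE' => F1 F2 EE'.
have EF : same_edges E (F1 ++ F2).
  move: EE'; rewrite /same_edges map_cat /= -e_ab.
  by rewrite perm_sym -cat1s perm_catCA perm_cons perm_sym map_cat.
rewrite (rank_middle F1 e F2).
have -> : rank_poly (e :: F1 ++ F2) = rank_poly ((a, b) :: F1 ++ F2).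
  by have [->|->] := und_pairP (esym e_ab); rewrite // rank_flip.
rewrite !rank_cons (IH _ _ _ EF) // (IH _ _ _ (same_relabel (collapse a b) EF))
  //.
by rewrite size_map.
Qed.

Lemma rank_perm (V : finType) (E E' : seq (V * V)) :
  perm_eq E E' -> rank_poly E = rank_poly E'.
Proof. by move/perm_same/rank_same. Qed.

Lemma count_joins (V : finType) (a b : V) (E : seq (V * V)) :
  count (joins a b) E = count_mem [set a; b] (map (@und V) E).
Proof.
rewrite count_map; apply: eq_count => e /=.
apply/orP/eqP => [[/eqP->|/eqP->]|]; rewrite /und //=; first by rewrite setUC.
by move/und_pairP => [->|->]; [left|right].
Qed.

Lemma same_edgesP (V : finType) (E E' : seq (V * V)) :
  reflect (forall a b, count (joins a b) E = count (joins a b) E')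
          (same_edges E E').
Proof.
apply: (iffP idP) => [EE' a b|cnt].
  by rewrite !count_joins; apply: (seq.permP EE').
apply/allP => A; rewrite mem_cat => A_in.
have [a [b ->]] : exists a b, A = [set a; b].
  by case/orP: A_in => /mapP[e _ ->]; exists e.1, e.2.
by rewrite /= -!count_joins cnt.
Qed.

Definition nneg2 (p : {poly {poly int}}) : Prop := forall i j, 0 <= p`_i`_j.

Lemma nneg2D p q : nneg2 p -> nneg2 q -> nneg2 (p + q).
Proof. by move=> p0 q0 i j; rewrite !coefD addr_ge0. Qed.

Lemma nneg2M p q : nneg2 p -> nneg2 q -> nneg2 (p * q).
Proof.
move=> p0 q0 i j; rewrite coefM coef_sum sumr_ge0 // => k _.
by rewrite coefM sumr_ge0 // => l _; rewrite mulr_ge0.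
Qed.

Lemma nneg2_0 : nneg2 0.
Proof. by move=> i j; rewrite !coef0. Qed.

Lemma nneg2_1 : nneg2 1.
Proof. by move=> i j; rewrite coef1; case: (i == _);
  rewrite ?coef1 ?coef0 ?ler0n. Qed.

Lemma nneg2_X : nneg2 'X.
Proof. by move=> i j; rewrite coefX; case: (i == _);
  rewrite ?coef1 ?coef0 ?ler0n. Qed.

Lemma nneg2_y : nneg2 yvar.
Proof. by move=> i j; rewrite coefC; case: (i == _);
  rewrite ?coefX ?coef0 ?ler0n. Qed.

Lemma rank_nneg (V : eqType) (E : seq (V * V)) : nneg2 (rank_poly E).
Proof.
have [m] := ubnP (size E); elim: m E => // m IH [|[a b] E] lt_m;
  first exact: nneg2_1.
rewrite rank_cons; case: ifP => _; first by apply: nneg2M (nneg2_y) (IH _ _).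
apply: nneg2D (IH _ _) (nneg2M nneg2_X (IH _ _)) => //; by rewrite size_map.
Qed.

(** The rank of a set of edges is at most the number of vertices minus the
    number of connected components; a colouring constant along the edges
    bounds the latter from below. *)
Lemma size_rank (V C : finType) (chi : V -> C) (S : {set V}) (E : seq (V * V)) :
    {subset ends E <= S} -> {in E, forall e, chi e.1 = chi e.2} ->
  (size (rank_poly E) + #|chi @: S| <= #|S|.+1)%N.
Proof.
have [m] := ubnP (size E); elim: m S E => // m IH S [|[a b] E] lt_m sub mono.
  by rewrite size_poly1 add1n ltnS leq_imset_card.
have [aS bS] : a \in S /\ b \in S by split; apply: sub; rewrite !inE eqxx ?orbT.
have subE : {subset ends E <= S} by move=> x xE; apply: sub;
  rewrite !inE xE !orbT.
have monoE : {in E, forall e, chi e.1 = chi e.2}.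
  by move=> e eE; apply: mono; rewrite inE eE orbT.
have chi_ab : chi a = chi b by apply: (mono (a, b)); rewrite mem_head.
have {}IH1 := IH S E lt_m subE monoE.
rewrite rank_cons; case: eqVneq => [_|ab].
  by apply: leq_trans IH1; rewrite leq_add2r mul_polyC size_scale_leq.
have chiS : chi @: (S :\ b) = chi @: S.
  apply/eqP; rewrite eqEsubset imsetS ?subD1set //=;
    apply/subsetP => _ /imsetP[x xS ->].
  have [->|xb] := eqVneq x b; last by rewrite imset_f // !inE xb.
  by rewrite -chi_ab imset_f // !inE ab.
have subM : {subset ends (relabel (collapse a b) E) <= S :\ b}.
  move=> x; rewrite ends_relabel => /mapP[z /subE zS ->];
    rewrite !inE /collapse.
  by have [_|zb] := eqVneq z b; rewrite ?ab ?zb.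
have monoM : {in relabel (collapse a b) E, forall e, chi e.1 = chi e.2}.
  move=> _ /mapP[e eE ->] /=; rewrite /collapse.
  by have := monoE e eE; do 2![case: eqP => [->|_]]; rewrite -?chi_ab.
have := IH (S :\ b) _ _ subM monoM; rewrite size_map => /(_ lt_m).
rewrite chiS [#|S|](cardsD1 b) bS => IH2.
apply: leq_trans (leq_add (size_polyD _ _) (leqnn _)) _.
rewrite addn_maxl geq_max; apply/andP; split.
  by move: IH1; rewrite [#|S|](cardsD1 b) bS.
apply: leq_trans (leq_add (size_polyMleq _ _) (leqnn _)) _.
by rewrite size_polyX addSn.
Qed.

Lemma size_rank_conn (V : finType) (S : {set V}) (E : seq (V * V)) :
  S != set0 -> {subset ends E <= S} -> (size (rank_poly E) <= #|S|)%N.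
Proof.
move=> S0 sub; have := @size_rank V unit (fun=> tt) S E sub (fun e _ => erefl).
suff -> : [set tt | _ in S] = [set tt] by rewrite cards1 addn1 ltnS.
apply/setP => -[]; rewrite inE eqxx; apply/imsetP.
by case/set0Pn: S0 => x xS; exists x.
Qed.

Lemma endsP (V : eqType) (E : seq (V * V)) (P : pred V) :
  (forall x, x \in ends E -> P x) <-> {in E, forall e, P e.1 && P e.2}.
Proof.
split=> [EP e /mem_ends /andP[e1 e2]|EP x]; first by rewrite !EP.
by case/flatten_mapP => e /EP /andP[e1 e2]; rewrite !inE => /orP[] /eqP->.
Qed.

(** The rank is additive over two graphs sharing at most one vertex w.  In the
    induction, an edge of the first graph is contracted onto an end that may
    be w, so that the second graph is not relabelled. *)
Lemma rank_glue1 (V : finType) (w : V) (S : {set V}) (E1 E2 : seq (V * V)) :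
    {subset ends E1 <= w |: S} -> {in ends E2, forall x, x \notin S} ->
  w \notin S ->
  rank_poly (E1 ++ E2) = rank_poly E1 * rank_poly E2.
Proof.
have [m] := ubnP (size E1);
  elim: m S E1 => // m IH S [|[a b] E1] lt_m sub off wS.
  by rewrite mul1r.
wlog b_w : a b lt_m sub / (a != b) ==> (b \in S).
  move=> gen; have [ab|ab] := eqVneq a b; first by apply: gen;
    rewrite // ab eqxx.
  have [bS|bS] := boolP (b \in S); first by apply: gen; rewrite ?bS ?implybT.
  rewrite cat_cons ![rank_poly ((a, b) :: _)]rank_flip; apply: gen => //.
    by move=> x xE; apply: sub; move: xE; rewrite !inE orbCA.
  have := sub a; have := sub b; rewrite !inE (negbTE bS) !eqxx !orbT orbF.
  move=> /(_ isT)/eqP b_w /(_ isT)/orP[/eqP a_w|->]; last exact: implybT.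
  by rewrite a_w b_w eqxx in ab.
have subE : {subset ends E1 <= w |: S} by move=> x xE; apply: sub;
  rewrite !inE xE !orbT.
rewrite cat_cons !rank_cons; have [_|ab] := eqVneq a b;
  first by rewrite (IH S) // mulrA.
have bS : b \in S by rewrite ab in b_w.
have aS : a \in w |: S by apply: sub; rewrite !inE eqxx.
rewrite relabel_cat [relabel _ E2]relabel_id_in => [|x /off]; last first.
  by rewrite /collapse; case: eqP => // ->; rewrite bS.
rewrite (IH S) // (IH (S :\ b)) ?size_map //; first by ring.
- move=> x; rewrite ends_relabel => /mapP[z /subE zS ->];
  rewrite !inE /collapse.
  have [_|zb] := eqVneq z b; last by move: zS; rewrite !inE zb.
  by move: aS; rewrite !inE ab.
- by move=> x /off xS; rewrite !inE (negbTE xS) andbF.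
- by rewrite !inE (negbTE wS) andbF.
Qed.

(** * Gluing along two vertices *)

(** A and B collect the sets of edges of E1 that leave r and w disconnected,
    respectively connect them.  An edge between r and w is the only case that
    feeds A into B: once it is contracted, E1 and E2 share one vertex.  The
    quantification over E2 inside the existential says that A and B are
    invariants of the piece alone, which [rank_shift] exploits by attaching
    the same piece to different graphs. *)
Lemma rank_glue2 (V : finType) (r w : V) (S : {set V}) (E1 : seq (V * V)) :
    {subset ends E1 <= r |: (w |: S)} -> r != w -> r \notin S -> w \notin S ->
  exists A B, [/\ nneg2 A, nneg2 B, (size A <= #|S|.+1)%N,
    (size B <= #|S|.+2)%N &
    forall E2, {in ends E2, forall x, x \notin S} ->
      rank_poly (E1 ++ E2) =
      A * rank_poly E2 + B * rank_poly (relabel (collapse r w) E2)].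
Proof.
move=> sub0 rw rS0 wS0; have [m] := ubnP (size E1).
elim: m S E1 sub0 rS0 wS0 => // m IH S [|[a b] E1] sub rS wS lt_m.
  exists 1, 0; split; rewrite ?size_poly1 ?size_poly0 //.
  - exact: nneg2_1.
  - exact: nneg2_0.
  by move=> E2 _; rewrite mul1r mul0r addr0.
wlog b_w : a b lt_m sub / [|| a == b, (a == r) && (b == w) | b \in S].
  move=> gen.
  have flip : {subset ends ((b, a) :: E1) <= r |: (w |: S)}.
    by move=> x xE; apply: sub; move: xE; rewrite !inE orbCA.
  have [ok|nok] := boolP [|| a == b, (a == r) && (b == w) | b \in S].
    exact: (gen a b).
  case: (gen b a) => // [|A [B [A0 B0 szA szB AB]]].
    have := sub a; have := sub b; rewrite !inE !eqxx !orbT.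
    move=> /(_ isT) b_in /(_ isT) a_in; move: nok b_in a_in.
    by case: (a \in S); case: (b \in S); do !case: eqP => //=; congruence.
  by exists A, B; split=> // E2 /AB <-; rewrite !cat_cons rank_flip.
have subE : {subset ends E1 <= r |: (w |: S)}.
  by move=> x xE; apply: sub; rewrite !inE xE !orbT.
have [A [B [A0 B0 szA szB AB]]] := IH S E1 subE rS wS lt_m.
have [ab|ab] := eqVneq a b.
  exists (yvar * A), (yvar * B); split.
  - exact: nneg2M nneg2_y A0.
  - exact: nneg2M nneg2_y B0.
  - by rewrite mul_polyC (leq_trans (size_scale_leq _ _)).
  - by rewrite mul_polyC (leq_trans (size_scale_leq _ _)).
  by move=> E2 /AB EE2; rewrite cat_cons rank_cons ab eqxx EE2 mulrDr !mulrA.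
have size_mulX (p : {poly {poly int}}) : (size ('X * p)%R <= (size p).+1)%N.
  by apply: leq_trans (size_polyMleq _ _) _; rewrite size_polyX addSn.
case/or3P: b_w => [/eqP a_b|/andP[/eqP a_r /eqP b_w]|bS];
  first by rewrite a_b eqxx in ab.
  subst a b; set F := relabel (collapse r w) E1.
  have subF : {subset ends F <= r |: S}.
    move=> x; rewrite ends_relabel => /mapP[z /subE zS ->];
      rewrite !inE /collapse.
    by have [_|zw] := eqVneq z w; rewrite ?eqxx //; move: zS;
      rewrite !inE (negbTE zw).
  exists A, (B + 'X * rank_poly F); split=> //.
  - exact: nneg2D B0 (nneg2M nneg2_X (rank_nneg _)).
  - apply: leq_trans (size_polyD _ _) _; rewrite geq_max szB /=.
    apply: leq_trans (size_mulX _) _; rewrite ltnS.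
    have : (size (rank_poly F) <= #|r |: S|)%N.
      by apply: size_rank_conn subF; apply/set0Pn; exists r; rewrite !inE eqxx.
    by rewrite cardsU1 rS.
  move=> E2 off; rewrite cat_cons rank_cons (negbTE ab) (AB _ off) relabel_cat.
  rewrite (rank_glue1 subF) //; first by ring.
  move=> x; rewrite ends_relabel => /mapP[z /off zS ->]; rewrite /collapse.
  by case: eqP.
have aS : a \in r |: (w |: S) by apply: sub; rewrite !inE eqxx.
case: (IH (S :\ b) (relabel (collapse a b) E1)); rewrite ?size_map //.
- move=> x; rewrite ends_relabel => /mapP[z /subE zS ->];
  rewrite !inE /collapse.
  have [_|zb] := eqVneq z b; last by move: zS; rewrite !inE zb.
  by move: aS; rewrite !inE ab.
- by rewrite !inE (negbTE rS) andbF.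
- by rewrite !inE (negbTE wS) andbF.
move=> A1 [B1 [A10 B10 szA1 szB1 AB1]].
have cardS : #|S| = #|S :\ b|.+1 by rewrite (cardsD1 b S) bS.
exists (A + 'X * A1), (B + 'X * B1); split.
- exact: nneg2D A0 (nneg2M nneg2_X A10).
- exact: nneg2D B0 (nneg2M nneg2_X B10).
- apply: leq_trans (size_polyD _ _) _; rewrite geq_max szA /=.
  by apply: leq_trans (size_mulX _) _; rewrite ltnS cardS.
- apply: leq_trans (size_polyD _ _) _; rewrite geq_max szB /=.
  by apply: leq_trans (size_mulX _) _; rewrite ltnS cardS.
move=> E2 off; rewrite cat_cons rank_cons (negbTE ab) (AB _ off) relabel_cat.
rewrite [relabel (collapse a b) E2]relabel_id_in => [|x /off]; last first.
  by rewrite /collapse; case: eqP => // ->; rewrite bS.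
rewrite AB1 => [|x /off xS]; last by rewrite !inE (negbTE xS) andbF.
ring.
Qed.

(** Contracting r and w turns a set of edges counted by B into one of rank
    smaller by 1: hence B is multiplied by (y - 1) / t.  The identities follow
    by gluing E to the empty graph and to a single edge between r and w. *)
Lemma rank_glue2_contract (V : finType) (r w : V) (E : seq (V * V)) A B :
    r != w ->
    (forall F, {subset ends F <= [set r; w]} ->
       rank_poly (E ++ F) =
       A * rank_poly F + B * rank_poly (relabel (collapse r w) F)) ->
  rank_poly E = A + B /\
  'X * rank_poly (relabel (collapse r w) E) = 'X * A + (yvar - 1) * B.
Proof.
move=> rw AB; have EAB : rank_poly E = A + B.
  by have := AB [::] (fun _ => ltac:(by [])); rewrite cats0 !mulr1.
split=> //; have := AB [:: (r, w)].
have -> : rank_poly (E ++ [:: (r, w)]) = rank_poly ((r, w) :: E).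
  by apply: rank_perm; rewrite perm_catC.
rewrite !rank_cons /= collapse_eq (negbTE rw) !eqxx ?orbT /= EAB.
have r2 : {subset ends [:: (r, w)] <= [set r; w]} by move=> x; rewrite !inE.
move/(_ r2) => H.
have -> : 'X * rank_poly (relabel (collapse r w) E) =
  (A + B + 'X * rank_poly (relabel (collapse r w) E)) - (A + B) by ring.
by rewrite H; rewrite /rank_poly /=; ring.
Qed.

(** The cancellation described at the top, for arbitrary pieces: E1 hangs at
    {r, v1}, E2 at {r, vk}, and F is any graph that becomes indistinguishable
    under the two contractions of r with v1 and of r with vk.  The transposition
    of v1 and vk moves E2 from vk to v1. *)
Lemma rank_shift (V : finType) (r v1 vk : V) (S1 S2 M : {set V})
    (E1 E2 F : seq (V * V)) :
    uniq [:: r; v1; vk] ->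
    {subset ends E1 <= r |: (v1 |: S1)} ->
    {subset ends E2 <= r |: (vk |: S2)} ->
    {subset ends F <= r |: (v1 |: (vk |: M))} ->
    [disjoint S1 & S2 :|: M :|: [set r; v1; vk]] ->
    [disjoint S2 & S1 :|: M :|: [set r; v1; vk]] ->
    [disjoint M & [set r; v1; vk]] ->
    rank_poly (relabel (collapse r v1) F) = rank_poly (relabel (collapse r vk)
      F) ->
  exists D, [/\ nneg2 D, (size D <= #|S1| + #|S2| + #|M| + 3)%N &
    'X * (rank_poly (E1 ++ E2 ++ F) -
          rank_poly (E1 ++ relabel (tperm v1 vk) E2 ++ F)) =
    ('X - (yvar - 1)) * D].
Proof.
rewrite /= !inE negb_or andbT => /andP[/andP[rv1 rvk] v1k] sub1 sub2 subF.
move=> dis1 dis2 disM symF.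
have out1 x : x \in S1 -> [&& x \notin S2, x \notin M, x != r, x != v1 & x !=
  vk].
  by move/(disjointFr dis1)/negbT; rewrite !inE !negb_or -!andbA.
have out2 x : x \in S2 -> [&& x \notin S1, x \notin M, x != r, x != v1 & x !=
  vk].
  by move/(disjointFr dis2)/negbT; rewrite !inE !negb_or -!andbA.
have outM x : x \in M -> [&& x != r, x != v1 & x != vk].
  by move/(disjointFr disM)/negbT; rewrite !inE !negb_or -!andbA.
have [vr1 vrk vk1] : [/\ v1 != r, vk != r & vk != v1].
  by split; rewrite eq_sym.
have offP (S : {set V}) x : (forall z, z \in S ->
  [&& z != r, z != v1 & z != vk]) ->
    x \in [:: r; v1; vk] -> x \notin S.
  move=> SP x3; apply/negP => /SP; move: x3; rewrite !inE.
  by case/or3P => /eqP->; rewrite eqxx ?andbF.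
have out13 x : x \in S1 -> [&& x != r, x != v1 & x != vk].
  by case/out1/and3P => _ _.
have out23 x : x \in S2 -> [&& x != r, x != v1 & x != vk].
  by case/out2/and3P => _ _.
have rI : r \in [:: r; v1; vk] by rewrite !inE eqxx.
have v1I : v1 \in [:: r; v1; vk] by rewrite !inE eqxx orbT.
have vkI : vk \in [:: r; v1; vk] by rewrite !inE eqxx !orbT.
have [A1 [B1 [A10 B10 szA1 szB1 AB1]]] :=
  rank_glue2 sub1 rv1 (offP _ _ out13 rI) (offP _ _ out13 v1I).
have [A2 [B2 [A20 B20 szA2 szB2 AB2]]] :=
  rank_glue2 sub2 rvk (offP _ _ out23 rI) (offP _ _ out23 vkI).
set F' := relabel (collapse r vk) F.
have subF' : {subset ends F' <= r |: (v1 |: M)}.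
  move=> x; rewrite ends_relabel => /mapP[z /subF zS ->]; rewrite /collapse.
  by have [_|zk] := eqVneq z vk; move: zS; rewrite !inE ?eqxx // (negbTE zk).
have [A [B [A0 B0 szA szB AB]]] :=
  rank_glue2 subF' rv1 (offP _ _ outM rI) (offP _ _ outM v1I).
exists (B1 * B2 * A); split.
- by do !apply: nneg2M.
- apply: leq_trans (size_polyMleq _ _) _; rewrite -subn1 leq_subLR.
  have szB12 : (size (B1 * B2)%R <= #|S1| + #|S2| + 3)%N.
    apply: leq_trans (size_polyMleq _ _) _; rewrite -subn1 leq_subLR.
    apply: leq_trans (leq_add szB1 szB2) _.
    by rewrite !addnS !addSn !addn0 add0n.
  apply: leq_trans (leq_add szB12 szA) _.
  by rewrite !addnS !addSn !addn0 add0n addnAC.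
have off2 E : {subset ends E <= r |: (v1 |: S1)} \/ {subset ends E <= r |: (v1
  |: (vk |: M))} ->
    {in ends E, forall x, x \notin S2}.
  move=> EE x xE; apply/negP => /out2 /and5P[xS1 xM xr x1 xk].
  case: EE => /(_ x xE); rewrite !inE (negbTE xr) (negbTE x1) ?(negbTE xk) /=.
    by rewrite (negbTE xS1).
  by rewrite (negbTE xM).
have off1 E : {subset ends E <= r |: (v1 |: (vk |: M))} ->
    {in ends E, forall x, x \notin S1}.
  move=> EE x xE; apply/negP => /out1 /and5P[_ xM xr x1 xk].
  by move: (EE x xE); rewrite !inE (negbTE xr) (negbTE x1) (negbTE xk) (negbTE
    xM).
have off_col (S : {set V}) v E :
  r \notin S -> {in ends E, forall x, x \notin S} ->
    {in ends (relabel (collapse r v) E), forall x, x \notin S}.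
  move=> rS off x; rewrite ends_relabel => /mapP[z /off zS ->].
  by rewrite /collapse; case: eqP.
have off2EF : {in ends (E1 ++ F), forall x, x \notin S2}.
  by move=> x; rewrite ends_cat mem_cat => /orP[]; apply: off2; [left|right].
have offMpair w' (S : {set V}) G : {subset ends G <= [set r; w']} ->
    r \notin S -> w' \notin S -> {in ends G, forall x, x \notin S}.
  by move=> sG rS wS x /sG; rewrite !inE => /orP[] /eqP->.
have [_ M1] := @rank_glue2_contract _ r v1 E1 A1 B1 rv1
  (fun G sG => AB1 G (offMpair _ _ _ sG (offP _ _ out13 rI) (offP _ _ out13
    v1I))).
have [F'AB MF'] := @rank_glue2_contract _ r v1 F' A B rv1
  (fun G sG => AB G (offMpair _ _ _ sG (offP _ _ outM rI) (offP _ _ outM v1I))).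
have T_eq : rank_poly (E1 ++ E2 ++ F) =
    A2 * rank_poly (E1 ++ F) +
    B2 * (A1 * rank_poly F' + B1 * rank_poly (relabel (collapse r v1) F')).
  have -> : rank_poly (E1 ++ E2 ++ F) = rank_poly (E2 ++ (E1 ++ F)).
    by apply: rank_perm; rewrite perm_catCA.
  rewrite AB2 // relabel_cat [relabel _ E1]relabel_id_in => [|x /sub1 xS].
    rewrite -/F' (AB1 F') //; apply: (off_col S1 vk F); first exact: offP rI.
    exact: off1.
  rewrite /collapse; case: eqP xS => // ->.
  by rewrite !inE (negbTE vrk) (negbTE vk1) (negbTE (offP _ _ out13 vkI)).
(* Transposing the whole graph instead puts E2 back in place, so that A2 and
   B2 apply; the rest is then transposed, and contracting r with vk there
   is contracting r with v1 in the original. *)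
pose tau := tperm v1 vk.
have tauK : involutive tau by exact: tpermK.
have T'_eq : rank_poly (E1 ++ relabel tau E2 ++ F) =
    A2 * rank_poly (E1 ++ F) +
    B2 * (rank_poly (relabel (collapse r v1) E1) * rank_poly F').
  have -> : rank_poly (E1 ++ relabel tau E2 ++ F) =
            rank_poly (relabel tau (E2 ++ relabel tau (E1 ++ F))).
    rewrite relabel_cat relabel_comp [relabel _ (E1 ++ F)]relabel_id_in.
      by apply: rank_perm; rewrite perm_catCA.
    by move=> x _ /=; rewrite tauK.
  rewrite (rank_inj _ (@perm_inj _ tau)).
  rewrite AB2; last first.
    move=> x; rewrite ends_relabel => /mapP[z /off2EF zS ->].
    by rewrite /tau; case: tpermP => // _; apply: offP => //.
  rewrite (rank_inj _ (@perm_inj _ tau)).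
  congr (_ + _ * _); rewrite relabel_comp.
  have -> : rank_poly (relabel (collapse r vk \o tau) (E1 ++ F)) =
            rank_poly (relabel (collapse r v1) (E1 ++ F)).
    apply: rank_ker => x y _ _ /=; rewrite !collapse_eq (inj_eq perm_inj).
    have tau_rk z : (tau z == r) || (tau z == vk) = (z == r) || (z == v1).
      rewrite /tau; case: tpermP => [->|->|/eqP z1 /eqP zk].
      - by rewrite !eqxx !orbT.
      - by rewrite (negbTE vr1) (negbTE vrk) (negbTE v1k) (negbTE vk1).
      - by rewrite (negbTE z1) (negbTE zk).
    by rewrite !tau_rk.
  rewrite relabel_cat (@rank_glue1 _ r S1) ?symF //.
  - move=> x; rewrite ends_relabel => /mapP[z /sub1 zS ->]; rewrite /collapse.
    by have [_|z1] := eqVneq z v1; move: zS; rewrite !inE ?eqxx // (negbTE z1).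
  - by apply: off_col; [exact: offP rI | exact: off1].
  - exact: offP rI.
rewrite T_eq T'_eq F'AB.
transitivity (B2 * (A1 * (A + B) * 'X + B1 * ('X * rank_poly (relabel (collapse
  r v1) F')) -
   ('X * rank_poly (relabel (collapse r v1) E1)) * (A + B))); first by ring.
by rewrite M1 MF'; ring.
Qed.

(** * The Tutte polynomial at x = 1 *)

Lemma connect_homo (T T' : finType) (e : rel T) (e' : rel T') (h :
  T -> T') x y :
    (forall a b, e a b -> connect e' (h a) (h b)) ->
  connect e x y -> connect e' (h x) (h y).
Proof.
move=> he /connectP[p]; elim: p x =>
  [x _ ->|z p IH x /= /andP[xz /IH zp] /zp zy].
  exact: connect0.
exact: connect_trans (he _ _ xz) zy.
Qed.

Lemma adjE (G : mgraph) (a b : G) :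
  adj a b = ((a, b) \in edges G) || ((b, a) \in edges G).
Proof. by rewrite /adj /= -!has_pred1 -has_predU. Qed.

Lemma adj_sym (G : mgraph) : symmetric (@adj G).
Proof. by move=> a b; rewrite !adjE orbC. Qed.

Lemma connect_adj_sym (G : mgraph) : connect_sym (@adj G).
Proof. exact: sym_connect_sym (@adj_sym G). Qed.

Lemma edge_adj (G : mgraph) e : e \in edges G -> @adj G e.1 e.2.
Proof. by case: e => a b ab; rewrite adjE ab. Qed.

Lemma card_ident (V : finType) (u v : V) :
  u != v -> #|ident_vert u v| = #|V|.-1.
Proof.
move=> uv; rewrite card_sig -(cardC1 v); apply: eq_card => x.
by rewrite !inE; case: (eqVneq x v) => [->|//]; rewrite eq_sym (negbTE uv).
Qed.

Lemma rank_ident (V : finType) (u v : V) (E : seq (V * V)) :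
  rank_poly (relabel (ident_map u v) E) = rank_poly (relabel (collapse u v) E).
Proof. by rewrite -(rank_inj _ val_inj) relabel_comp. Qed.

Lemma connected_ident (V : finType) (a b : V) (E : seq (V * V)) :
    (forall x y, connect (@adj (@MGraph V ((a, b) :: E))) x y) ->
  forall x y, connect (@adj (@identify (@MGraph V E) a b)) x y.
Proof.
move=> conn x y.
have surj (z : ident_vert a b) : z = ident_map a b (val z).
  apply: val_inj => /=; case: z => z /= /orP[/negbTE->//|/eqP->].
  by case: eqP.
rewrite (surj x) (surj y); apply: connect_homo (conn (val x) (val y)) => c d.
have eq_ab : ident_map a b a = ident_map a b b.
  by apply: val_inj; rewrite /= eqxx; case: eqP.
rewrite adjE !inE -!orbA => /or4P[/eqP[-> ->]|cd|/eqP[-> ->]|dc].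
- by rewrite eq_ab connect0.
- by apply/connect1/(@edge_adj (@identify (@MGraph V E) a b) (_, _))/mapP;
  exists (c, d).
- by rewrite eq_ab connect0.
- apply/connect1; rewrite adj_sym.
  by apply/(@edge_adj (@identify (@MGraph V E) a b) (_, _))/mapP; exists (d, c).
Qed.

(** Colour the vertices by whether they are connected to a. *)
Lemma rank_disconnected (V : finType) (E : seq (V * V)) (a b : V) :
  ~~ connect (@adj (MGraph E)) a b -> (rank_poly E)`_(#|V|.-1) = 0.
Proof.
move=> nab; apply: nth_default; pose chi x := connect (@adj (MGraph E)) a x.
have := @size_rank V bool chi [set: V] E (fun x _ => in_setT x).
have -> : chi @: [set: V] = [set: bool].
  apply/setP=> -[]; rewrite in_setT; apply/imsetP; [exists a|exists b] => //.
    by rewrite /chi connect0.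
  by apply/esym/negbTE.
rewrite !cardsT card_bool addn2 ltnS => szE; rewrite -ltnS prednK;
  last by apply/card_gt0P; exists a.
apply: szE => e eE; rewrite /chi.
have e12 : connect (@adj (MGraph E)) e.1 e.2.
  by apply/connect1/(@edge_adj (MGraph E)).
by apply/(same_connect_r (@connect_adj_sym (MGraph E))).
Qed.

(** The rule for bridges agrees with plain deletion and contraction, since the
    deletion of a bridge is disconnected and does not reach the top degree. *)
Lemma tutte_rec_rank (m : nat) (G : mgraph) :
    size (edges G) = m -> connected G ->
  (tutte_rec m G).[1] = (rank_poly (edges G))`_(#|G|.-1).
Proof.
elim: m G => [|m IH] [V [|[a b] E]] //= sz [V0 conn].
  have -> : #|V|.-1 = 0%N.
    apply/eqP; rewrite -leqn0 -ltnS prednK //; apply/card_le1_eqP => x y _ _.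
    move: (conn x y) => /connectP[[_ ->//|z p /andP[]]].
    by rewrite adjE !in_nil.
  by rewrite hornerC coef1.
case: sz => sz; rewrite /is_loop /= rank_cons.
have delE : @delete_edge (@MGraph V ((a, b) :: E)) (a, b) = @MGraph V E.
  by rewrite /delete_edge /= eqxx.
have conn_del : connect (@adj (MGraph E)) a b ->
    forall x y, connect (@adj (MGraph E)) x y.
  move=> ab x y; apply: connect_sub (conn x y) => c d; rewrite adjE !inE -!orbA.
  case/or4P=> [/eqP[-> ->]|cd|/eqP[-> ->]|dc] //.
  - by apply: connect1; rewrite adjE cd.
  - by rewrite (@connect_adj_sym (MGraph E)).
  - by apply: connect1; rewrite adjE dc orbT.
have [ab|ab] := eqVneq a b.
  rewrite hornerCM mul_polyC coefZ; congr (_ * _); rewrite delE.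
  by apply: (IH (@MGraph V E)) => //; split=> //; apply: conn_del; rewrite ab.
have contE : (tutte_rec m (@contract_edge (@MGraph V ((a, b) :: E)) (a,
  b))).[1] =
             ('X * rank_poly (relabel (collapse a b) E))`_(#|V|.-1).
  have -> : @contract_edge (@MGraph V ((a, b) :: E)) (a, b) = @identify (MGraph
    E) a b.
    by rewrite /contract_edge /identify /= eqxx.
  rewrite IH /=; last 2 first.
  - by rewrite size_map.
  - split; first by apply/card_gt0P; exists (ident_map a b a).
    exact: connected_ident.
  rewrite card_ident // -rank_ident coefXM; case: eqP => // V1.
  have : (1 < #|V|)%N by rewrite (cardD1 a) (cardD1 b) !inE eq_sym ab.
  by case: #|V| V1 => [|[]].
have -> : @is_bridge (@MGraph V ((a, b) :: E)) (a, b) =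
          ~~ connect (@adj (MGraph E)) a b.
  by rewrite /is_bridge /delete_edge /= eqxx.
have [ab_conn|bridge] /= := boolP (connect (@adj (MGraph E)) a b).
  rewrite hornerD coefD contE delE; congr (_ + _).
  by apply: (IH (@MGraph V E)) => //; split=> //; apply: conn_del.
by rewrite hornerM hornerX mul1r contE coefD (rank_disconnected bridge) add0r.
Qed.

(** * Cones and fans *)

Definition cone_edges (V : finType) (E : seq (V * V)) :
    seq (option V * option V) :=
  [seq (None, Some a) | a <- enum V] ++ relabel Some E.

Lemma connected_cone (G : mgraph) : connected (cone G).
Proof.
split; first by apply/card_gt0P; exists None.
have spoke (x : cone G) : connect (@adj (cone G)) None x.
  case: x => [a|]; last exact: connect0.
  apply/connect1/(@edge_adj (cone G) (None, Some a)).
  by rewrite mem_cat map_f // mem_enum.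
move=> x y; apply: connect_trans (spoke y).
by rewrite connect_adj_sym.
Qed.

Lemma f_poly_rank (G : mgraph) :
  f_poly G = (rank_poly (cone_edges (edges G)))`_#|G|.
Proof. by rewrite /f_poly /tutte tutte_rec_rank ?card_option //;
  exact: connected_cone. Qed.

(** Moves a graph to a given vertex set, where graphs can be compared edge by
    edge. *)
Lemma f_poly_transfer (G : mgraph) (W : finType) (phi : G -> W) (E :
  seq (W * W)) :
    bijective phi -> same_edges (relabel phi (edges G)) E ->
  f_poly G = (rank_poly (cone_edges E))`_#|W|.
Proof.
move=> phi_bij GE; have phi_inj := bij_inj phi_bij.
rewrite f_poly_rank (bij_eq_card phi_bij); congr (nth _ (polyseq _) _).
have omap_inj : injective (omap phi).
  by move=> [x|] [y|] //= [/phi_inj ->].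
rewrite -(rank_inj _ omap_inj); rewrite relabel_cat; apply: rank_same.
apply: same_cat; last first.
  rewrite relabel_comp -[relabel _ _](relabel_comp Some phi).
  exact: same_relabel.
apply: perm_same; rewrite /relabel -map_comp.
rewrite (map_comp (fun a => (None, Some a)) phi); apply: perm_map.
apply: uniq_perm => [||x]; first by rewrite map_inj_uniq // enum_uniq.
  exact: enum_uniq.
rewrite mem_enum; case: phi_bij => psi _ psiK.
by rewrite -[x]psiK map_f ?mem_enum.
Qed.

Lemma f_poly_iso (G H : mgraph) : iso G H -> f_poly G = f_poly H.
Proof.
case=> phi phi_bij mult_phi.
rewrite (f_poly_transfer phi_bij (E := edges H)) ?f_poly_rank //.
have phi_inj := bij_inj phi_bij; case: phi_bij => psi phiK psiK.
apply/same_edgesP => a b; rewrite -[a]psiK -[b]psiK.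
have := mult_phi (psi a) (psi b); rewrite /mult => ->.
rewrite count_map; apply: eq_count => -[c d] /=.
by rewrite /joins /= !xpair_eqE !(inj_eq phi_inj).
Qed.

Definition path_edges (V : Type) (p : seq V) : seq (V * V) := zip p (behead p).

Lemma path_edges_map (V W : Type) (h : V -> W) (p : seq V) :
  relabel h (path_edges p) = path_edges (map h p).
Proof.
by case: p => // x p; rewrite /path_edges /=; elim: p x => //= y p IH x;
  rewrite -IH.
Qed.

Lemma path_edges_rcons (V : Type) (x y : V) (p : seq V) :
  path_edges (rcons (rcons p x) y) = rcons (path_edges (rcons p x)) (x, y).
Proof.
case: p => // z p; rewrite /path_edges /=.
by elim: p z => //= t p IH z; rewrite IH.
Qed.

Lemma path_edges_rev (V : finType) (p : seq V) :
  same_edges (path_edges (rev p)) (path_edges p).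
Proof.
elim: p => [|x [|y p] IH]; rewrite ?same_refl //.
rewrite !rev_cons path_edges_rcons -rev_cons -cats1.
apply: (@same_trans _ ([:: (y, x)] ++ path_edges (rev (y :: p)))).
  by apply: perm_same; rewrite perm_catC.
apply: (@same_cat _ [:: (y, x)] _ [:: (x, y)]) => //.
by rewrite /same_edges /= /und /= setUC.
Qed.

Definition fan (V : Type) (r : V) (p : seq V) : seq (V * V) :=
  [seq (r, x) | x <- p] ++ path_edges p.

Lemma relabel_fan (V W : Type) (h : V -> W) (r : V) (p : seq V) :
  relabel h (fan r p) = fan (h r) (map h p).
Proof.
by rewrite /fan relabel_cat path_edges_map /relabel -!map_comp.
Qed.

Lemma fan_rev (V : finType) (r : V) (p : seq V) :
  same_edges (fan r (rev p)) (fan r p).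
Proof.
apply: same_cat (path_edges_rev p).
by apply: perm_same; rewrite map_rev perm_rev.
Qed.

(** The involution of the vertices that reverses p and fixes all the others. *)
Definition flip_seq (V : eqType) (p : seq V) (x : V) : V :=
  if x \in p then nth x (rev p) (index x p) else x.

Lemma map_flip_seq (V : eqType) (p : seq V) :
  uniq p -> map (flip_seq p) p = rev p.
Proof.
move=> Up; case: p Up => // x0 q; set p := x0 :: q => Up.
apply: (@eq_from_nth _ x0); rewrite size_map ?size_rev // => i lt_i.
rewrite (nth_map x0) // /flip_seq mem_nth // index_uniq //.
by apply: set_nth_default; rewrite size_rev.
Qed.

Lemma flip_seqK (V : eqType) (p : seq V) : uniq p -> involutive (flip_seq p).
Proof.
move=> Up x; rewrite {2}/flip_seq; case: ifP => [xp|xp];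
  last by rewrite /flip_seq xp.
have lt_x : (index x p < size p)%N by rewrite index_mem.
have lt_j : (size p - (index x p).+1 < size p)%N by rewrite ltn_subrL
  (leq_ltn_trans _ lt_x).
rewrite nth_rev // /flip_seq mem_nth // index_uniq // nth_rev // subnSK //.
by rewrite subKn 1?ltnW // nth_index.
Qed.

(** Reversing the path is an automorphism of the fan that exchanges v1 and vk
    and fixes the apex r. *)
Lemma rank_fan_sym (V : finType) (r v1 vk : V) (mid : seq V) :
    uniq (r :: v1 :: rcons mid vk) ->
  rank_poly (relabel (collapse r v1) (fan r (v1 :: rcons mid vk))) =
  rank_poly (relabel (collapse r vk) (fan r (v1 :: rcons mid vk))).
Proof.
set p := v1 :: _; rewrite cons_uniq => /andP[rp Up].
have sigK := flip_seqK Up; set sig := flip_seq p in sigK.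
have sig_inj : injective sig := inv_inj sigK.
have sig_r : sig r = r by rewrite /sig /flip_seq (negbTE rp).
have sig_v1 : sig v1 = vk.
  have := map_flip_seq Up; rewrite -/sig /p /= rev_cons rev_rcons /= => -[-> _].
  by [].
have -> : rank_poly (relabel (collapse r vk) (fan r p)) =
          rank_poly (relabel (collapse r vk \o sig) (fan r p)).
  rewrite -(relabel_comp (collapse r vk) sig) (relabel_fan sig) sig_r
    map_flip_seq //.
  by apply: rank_same; rewrite same_sym; apply/same_relabel/fan_rev.
apply: rank_ker => x y _ _ /=; rewrite !collapse_eq (inj_eq sig_inj).
have sig_rE z : (sig z == r) = (z == r) by rewrite -{1}sig_r (inj_eq sig_inj).
have sig_vkE z : (sig z == vk) = (z == v1) by rewrite -sig_v1 (inj_eq sig_inj).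
by rewrite !sig_rE !sig_vkE.
Qed.

(** The part of the cone that hangs on the attaching vertex of a subtree: S
    holds the vertices of the subtree other than the attaching one, whose
    spoke is counted in the fan. *)
Definition pendant_cone (V : finType) (S : {set V}) (E : seq (V * V)) :
    seq (option V * option V) :=
  [seq (None, Some a) | a <- enum S] ++ relabel Some E.

Lemma ends_pendant_cone (V : finType) (v : V) (S : {set V}) (E : seq (V * V)) :
    {subset ends E <= v |: S} ->
  {subset ends (pendant_cone S E) <= None |: (Some v |: Some @: S)}.
Proof.
move=> sub x; rewrite ends_cat mem_cat ends_relabel =>
  /orP[|/mapP[z /sub zS ->]].
  rewrite /ends -map_comp => /flatten_mapP[a aS].
  rewrite !inE => /orP[]/eqP->; rewrite ?eqxx //.
  by rewrite mem_enum in aS; rewrite (mem_imset _ _ Some_inj) aS !orbT.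
rewrite !inE (mem_imset _ _ Some_inj) orFb; move: zS; rewrite !inE.
by case/orP=> [/eqP->|->]; rewrite ?eqxx ?orbT.
Qed.

Lemma ends_path_edges (V : eqType) (p : seq V) :
  {subset ends (path_edges p) <= p}.
Proof.
move=> x; rewrite /path_edges; case: p => // a p.
elim: p a => // b p IH a; rewrite /= !inE.
by case/or3P=> [->|->|/IH]; rewrite ?orbT // inE => ->; rewrite orbT.
Qed.

Lemma ends_fan (V : eqType) (r : V) (p : seq V) :
  {subset ends (fan r p) <= r :: p}.
Proof.
move=> x; rewrite ends_cat mem_cat inE =>
  /orP[/flatten_mapP[e /mapP[a ap ->]]|].
  by rewrite !inE => /orP[]/eqP->; rewrite ?eqxx ?ap ?orbT.
by move/ends_path_edges ->; rewrite orbT.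
Qed.

Lemma cone_edges_parts (V : finType) (S1 S2 : {set V}) (p : seq V)
    (E1 E2 : seq (V * V)) :
    perm_eq (enum V) (enum S1 ++ enum S2 ++ p) ->
  perm_eq (cone_edges (E1 ++ E2 ++ path_edges p))
    (pendant_cone S1 E1 ++ pendant_cone S2 E2 ++ fan None (map Some p)).
Proof.
move=> Vparts; rewrite /cone_edges /pendant_cone /fan -path_edges_map
  !relabel_cat.
apply/seq.permP => P; rewrite !count_cat.
rewrite (seq.permP (perm_map _ Vparts)) !map_cat !count_cat -map_comp.
ring.
Qed.

(** Compares the coefficients of t ^ (#|V| + 1) in the identity of
    [rank_shift]: by the degree bound, the term with y - 1 does not
    contribute. *)
Lemma rank_cone_shift (V : finType) (v1 vk : V) (mid : seq V)
    (S1 S2 : {set V}) (E1 E2 : seq (V * V)) (p := v1 :: rcons mid vk) :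
    uniq p -> {subset ends E1 <= v1 |: S1} -> {subset ends E2 <= vk |: S2} ->
    [disjoint S1 & S2] -> {in p, forall x, (x \notin S1) && (x \notin S2)} ->
    (forall x, [|| x \in S1, x \in S2 | x \in p]) ->
  forall i, 0 <= (rank_poly (cone_edges (E1 ++ E2 ++ path_edges p)) -
    rank_poly (cone_edges (E1 ++ relabel (tperm v1 vk) E2 ++ path_edges
      p)))`_#|V|`_i.
Proof.
move=> Up sub1 sub2 dis12 offp cover i.
have Vparts : perm_eq (enum V) (enum S1 ++ enum S2 ++ p).
  apply: uniq_perm => [||x]; first exact: enum_uniq.
    rewrite !cat_uniq !enum_uniq Up !andTb andbT; apply/andP; split.
      apply/hasPn => x; rewrite mem_cat !mem_enum => /orP[|/offp/andP[]//].
      by move/(disjointFl dis12) ->.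
    by apply/hasPn => x /offp/andP[_]; rewrite mem_enum.
  by rewrite mem_enum !mem_cat !mem_enum cover.
have cardV : #|V| = (#|S1| + #|S2| + size mid + 2)%N.
  have := perm_size Vparts; rewrite !size_cat -!cardE => ->;
    rewrite /= size_rcons.
  by rewrite !addnS addn0 addnA.
rewrite !(rank_perm (cone_edges_parts _ _ Vparts)).
have -> : pendant_cone S2 (relabel (tperm v1 vk) E2) =
    relabel (tperm (Some v1) (Some vk)) (pendant_cone S2 E2).
  rewrite /pendant_cone [RHS]relabel_cat !relabel_comp; congr (_ ++ _).
    rewrite /relabel -map_comp; apply/eq_in_map => x; rewrite mem_enum => xS /=.
    have xp y : y \in p -> x != y.
      by move=> /offp/andP[_ yS]; apply: contraNneq yS => <-.
    have x1 : x != v1 by rewrite xp ?mem_head.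
    have xk : x != vk by rewrite xp // inE mem_rcons mem_head orbT.
    by rewrite !tpermD ?(inj_eq Some_inj) // eq_sym.
  apply: eq_in_relabel => x _ /=; exact: inj_tperm Some_inj.
have UpS : uniq (None :: map Some p).
  rewrite cons_uniq map_inj_uniq ?Up ?andbT; last exact: Some_inj.
  by apply/mapP=> -[].
have def_pS : map Some p = Some v1 :: rcons (map Some mid) (Some vk).
  by rewrite /p /= map_rcons.
have inS (S : {set V}) x : (Some x \in Some @: S) = (x \in S).
  by rewrite (mem_imset _ _ Some_inj).
have noneS (S : {set V}) : None \notin Some @: S by apply/imsetP => -[].
have midp x : x \in mid -> x \in p by move=> xm;
  rewrite inE mem_rcons inE xm !orbT.
have [v1p vkp] : v1 \in p /\ vk \in p by split;
  rewrite ?mem_head // inE mem_rcons mem_head orbT.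
have [v1k v1mid vkmid] : [/\ v1 != vk, v1 \notin mid & vk \notin mid].
  move: Up; rewrite /= rcons_uniq mem_rcons inE negb_or.
  by case/and3P=> /andP[-> ->] ->.
have disj (A B : {set V}) : [disjoint A & B] -> {in p, forall x, x \notin A} ->
    [disjoint Some @: A & Some @: B :|: Some @: [set x in mid] :|:
              [set None; Some v1; Some vk]].
  move=> AB Ap; apply/pred0P => -[x|]; rewrite !inE ?inS; last first.
    by rewrite (negbTE (noneS A)).
  rewrite !(inj_eq Some_inj) inE orFb; apply/negP => /andP[xA].
  rewrite (disjointFr AB xA) orFb.
  have xp y : y \in p -> x != y by move=> /Ap yA; apply: contraNneq yA => <-.
  rewrite (negbTE (xp _ v1p)) (negbTE (xp _ vkp)) !orbF => /midp/Ap.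
  by rewrite xA.
case: (@rank_shift _ None (Some v1) (Some vk) (Some @: S1) (Some @: S2)
   (Some @: [set x in mid]) (pendant_cone S1 E1) (pendant_cone S2 E2)
   (fan None (map Some p))).
- by rewrite /= !inE /= (inj_eq Some_inj) v1k.
- exact: ends_pendant_cone.
- exact: ends_pendant_cone.
- move=> x /ends_fan; rewrite def_pS !inE mem_rcons inE.
  case: x => [x|//]; rewrite inS inE (mem_map Some_inj).
  by case/or4P=> ->; rewrite ?orbT.
- by apply: disj => // x /offp/andP[].
- by apply: disj => [|x /offp/andP[] //]; rewrite disjoint_sym.
- apply/pred0P => -[x|]; rewrite !inE ?inS; last by rewrite (negbTE (noneS _)).
  rewrite !(inj_eq Some_inj) inE orFb; apply/negP => /andP[xm].
  by case/orP=> /eqP x_eq; rewrite x_eq ?(negbTE v1mid) ?(negbTE vkmid) in xm.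
- by rewrite def_pS; apply: rank_fan_sym; rewrite -def_pS.
move=> D [D0 szD eqD].
move: szD; rewrite !card_imset; try exact: Some_inj.
have -> : #|[set x in mid]| = size mid.
  rewrite cardsE; apply/card_uniqP; move: Up; rewrite /= rcons_uniq.
  by case/and3P.
rewrite addnS -cardV => szD.
have := congr1 (fun q : {poly {poly int}} => q`_(#|V|.+1)) eqD.
rewrite coefXM /= => ->.
rewrite mulrBl coefB coefXM /= /yvar -polyCB mul_polyC coefZ.
by rewrite [D`_(#|V|.+1)]nth_default // mulr0 subr0.
Qed.

(** * The path of a shift in a tree *)

Lemma path_edges_cat (V : Type) (x u : V) (s1 s2 : seq V) :
  path_edges (x :: s1 ++ u :: s2) =
  path_edges (x :: s1) ++ (last x s1, u) :: path_edges (u :: s2).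
Proof. by elim: s1 x => //= y s1 IH x; rewrite /path_edges /= -IH. Qed.

Lemma path_edges_nth (V : Type) (d x : V) (q : seq V) :
  path_edges (x :: q) =
  [seq (nth d (x :: q) i, nth d (x :: q) i.+1) | i <- iota 0 (size q)].
Proof.
elim: q x => //= y q IH x; rewrite /path_edges /= -/(path_edges (y :: q)) IH.
by congr (_ :: _); rewrite (iotaDl 1 0) -map_comp.
Qed.

Lemma path_edgesP (V : eqType) (e : rel V) x s :
  path e x s -> {in path_edges (x :: s), forall d, e d.1 d.2}.
Proof.
elim: s x => // y s IH x /= /andP[xy /IH sP] d.
by rewrite /path_edges /= inE => /predU1P[->|/sP].
Qed.

Lemma joins_sym (V : eqType) (a b c d : V) :
  joins a b (c, d) = joins c d (a, b).
Proof.
rewrite /joins /= !xpair_eqE ![_ == c]eq_sym ![_ == d]eq_sym; congr (_ || _).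
by rewrite andbC.
Qed.

Lemma count_path_edges (V : eqType) (a b : V) (p : seq V) :
  uniq p -> (count (joins a b) (path_edges p) <= 1)%N.
Proof.
case: p => // x p; elim: p x => // y p IH x.
rewrite cons_uniq => /andP[xp Up].
have -> : path_edges (x :: y :: p) = (x, y) :: path_edges (y :: p) by [].
rewrite /=; case xyab: (joins a b (x, y)); last exact: IH Up.
suff -> : count (joins a b) (path_edges (y :: p)) = 0%N by [].
apply/eqP; rewrite -leqn0 leqNgt -has_count; apply/hasPn => -[c d] cd.
have /andP[cp dp] : (c \in y :: p) && (d \in y :: p).
  by have /andP[/ends_path_edges-> /ends_path_edges->] := mem_ends cd.
have [xc xd] : x != c /\ x != d by split; apply: contraNneq xp => ->.
move: xyab xc xd; rewrite /joins /= !xpair_eqE.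
by do !case: eqP => //=; congruence.
Qed.

Definition on_path (T : eqType) (p : seq T) (e : T * T) : bool :=
  has (fun d => joins d.1 d.2 e) (path_edges p).

Lemma on_path_joins (T : eqType) (p : seq T) (a b : T) (e : T * T) :
  joins a b e -> on_path p e = has (joins a b) (path_edges p).
Proof.
case: e => c d cd; apply: eq_has => -[x y] /=; rewrite joins_sym.
by move: cd; rewrite /joins /= !xpair_eqE => /orP[]/andP[/eqP-> /eqP->] //;
   rewrite orbC.
Qed.

Lemma on_path_ends (T : eqType) (p : seq T) (e : T * T) :
  on_path p e -> (e.1 \in p) && (e.2 \in p).
Proof.
case/hasP=> d /mem_ends /andP[/ends_path_edges d1 /ends_path_edges d2].
by case/orP=> /eqP->; rewrite /= ?d1 ?d2.
Qed.

Lemma edges_remove_path (T : mgraph) (v1 : T) (mid : seq T) (vk : T) :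
  edges (remove_path v1 mid vk) =
  [seq e <- edges T | [&& ~~ on_path (v1 :: rcons mid vk) e,
                          e.1 \notin mid & e.2 \notin mid]].
Proof. by []. Qed.

Lemma adjP (G : mgraph) (a b : G) :
  reflect (exists2 e, e \in edges G & joins a b e) (adj a b).
Proof. exact: hasP. Qed.

(** An interior vertex u already has two incident edges on the path, which
    exhaust its degree. *)
Lemma mid_on_path (T : mgraph) (v1 : T) (mid : seq T) (vk : T) e :
    shift_path v1 mid vk -> e \in edges T -> (e.1 \in mid) || (e.2 \in mid) ->
  on_path (v1 :: rcons mid vk) e.
Proof.
case=> pathP Up deg2 eT e_mid.
have [u u_mid ue] : exists2 u, u \in mid & (e.1 == u) || (e.2 == u).
  by case/orP: e_mid => ?; [exists e.1|exists e.2]; rewrite ?eqxx ?orbT.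
apply/negPn/negP => noff; have := deg2 u u_mid.
case/splitPr: u_mid pathP Up noff => m1 m2 {deg2 e_mid}.
rewrite rcons_cat rcons_cons; case def_s: (rcons m2 vk) => [|b s].
  by case: m2 def_s.
set a := last v1 m1; set p := v1 :: _ => pathP Up noff deg2.
have pE : path_edges p = path_edges (v1 :: m1) ++ [:: (a, u), (u, b) &
  path_edges (b :: s)].
  by rewrite /p path_edges_cat.
have [adj_au adj_ub] : adj a u /\ adj u b.
  have adj_p := path_edgesP pathP.
  by split; [apply: (adj_p (a, u))|apply: (adj_p (u, b))];
    rewrite pE mem_cat !inE eqxx ?orbT.
have [e1 e1T e1J] := adjP _ _ adj_au; have [e2 e2T e2J] := adjP _ _ adj_ub.
have on1 : on_path p e1.
  by rewrite (on_path_joins _ e1J) pE has_cat /= /joins /= eqxx orbT.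
have on2 : on_path p e2.
  by rewrite (on_path_joins _ e2J) pE has_cat /= /joins /= eqxx !orbT.
have [ab au bu] : [/\ a != b, a != u & b != u].
  have aI : a \in v1 :: m1 by exact: mem_last.
  move: Up; rewrite /p -cat_cons cat_uniq => /and3P[_ /hasPn dis].
  rewrite /= !inE negb_or => /andP[/andP[ub _] _].
  split; last by rewrite eq_sym.
    by apply: contraTneq aI => ->; apply: dis; rewrite !inE eqxx orbT.
  by apply: contraTneq aI => ->; apply: dis; rewrite inE eqxx.
(* The two path edges at u differ since a != b, and e is not on the path. *)
have U3 : uniq [:: e; e1; e2].
  rewrite /= !inE negb_or andbT -andbA; apply/and3P; split.
  - by apply: contraNneq noff => ->.
  - by apply: contraNneq noff => ->.
  move: e1J e2J; case: (e1) => ? ?; case: (e2) => ? ?;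
    rewrite /joins /= !xpair_eqE.
  by move: ab au bu; do !case: eqP => //=; congruence.
have: (2 < degree u)%N.
  have incid d x y : joins x y d -> (x == u) || (y == u) ->
    (d.1 == u) || (d.2 == u).
    by case/orP=> /eqP-> //=; rewrite orbC.
  have : (size [:: e; e1; e2] <= size [seq d <- edges T | (d.1 == u) || (d.2 ==
    u)])%N.
    apply: uniq_leq_size => // d; rewrite !inE mem_filter.
    case/or3P=> /eqP->; first by rewrite ue.
      by rewrite (incid _ _ _ e1J) ?eqxx ?orbT.
    by rewrite (incid _ _ _ e2J) ?eqxx ?orbT.
  move/leq_trans; apply; rewrite size_filter -sum1_count big_mkcond /=.
  rewrite /degree; apply: leq_sum => d _.
  by case: (d.1 == u); case: (d.2 == u).
by rewrite deg2.
Qed.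

Lemma remove_path_adj (T : mgraph) (v1 : T) (mid : seq T) (vk : T) a b :
  @adj (remove_path v1 mid vk) a b ->
  [/\ @adj T a b, a \notin mid, b \notin mid &
      ~~ has (joins a b) (path_edges (v1 :: rcons mid vk))].
Proof.
case/adjP => e; rewrite edges_remove_path mem_filter =>
  /andP[/and3P[noff m1 m2] eT] eJ.
split; first by apply/adjP; exists e.
- by case/orP: eJ m1 m2 => /eqP->.
- by case/orP: eJ m1 m2 => /eqP->.
- by rewrite -(on_path_joins _ eJ).
Qed.

Lemma remove_path_path (T : mgraph) (v1 : T) (mid : seq T) (vk : T) x q :
  path (@adj (remove_path v1 mid vk)) x q -> all (fun y => y \notin mid) q.
Proof. by elim: q x => //= z q IH x /andP[/remove_path_adj[_ _ -> _] /IH]. Qed.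

Lemma remove_path_mid (T : mgraph) (v1 : T) (mid : seq T) (vk : T) x y :
  x \notin mid -> connect (@adj (remove_path v1 mid vk)) x y -> y \notin mid.
Proof.
move=> x_mid /connectP[q]; elim: q x x_mid =>
  [x ? _ ->|z q IH x _ /= /andP[xz zq]] //.
by apply: IH zq; case: (remove_path_adj xz).
Qed.

(** A path from v1 to vk avoiding the interior and the edges of the removed
    path would close up with it to a cycle.  The cycle has at least three
    vertices: otherwise both paths would be the single edge from v1 to vk. *)
Lemma remove_path_separates (T : mgraph) (v1 : T) (mid : seq T) (vk : T) :
    is_tree T -> shift_path v1 mid vk ->
  ~~ connect (@adj (remove_path v1 mid vk)) v1 vk.
Proof.
move=> [_ _ acyclic] [pathP Up _]; apply/negP => /connectP[q0 q0P].
case/shortenP: q0P => q qP Uq _ q_last.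
have [v1_mid vk_mid v1k Umid] :
  [/\ v1 \notin mid, vk \notin mid, v1 != vk & uniq mid].
  move: Up; rewrite /= mem_rcons inE negb_or rcons_uniq.
  by case/and3P=> /andP[-> ->] -> ->.
have q_mid := remove_path_path qP.
have qT : path (@adj T) v1 q.
  by apply: sub_path qP => x y /remove_path_adj[].
apply: (acyclic (v1 :: q ++ rev mid)); last first.
  apply/andP; split.
    rewrite /= rcons_cat cat_path qT -q_last.
    have := rev_path (@adj T) v1 (rcons mid vk).
    rewrite last_rcons belast_rcons rev_cons => ->.
    by rewrite (eq_path (e' := @adj T)) // => x y; rewrite adj_sym.
  rewrite -cat_cons cat_uniq Uq rev_uniq Umid andbT /=.
  apply/hasPn => x; rewrite mem_rev inE => x_mid; apply/norP; split.
    by apply: contraNneq v1_mid => <-.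
  by apply: contraL x_mid => /(allP q_mid).
case: q qP q_last {Uq q_mid qT} => [|z [|z' q]] //=.
- by move=> _ vk_eq; rewrite vk_eq eqxx in v1k.
- rewrite andbT => adj_z z_eq; rewrite -z_eq in adj_z.
  rewrite size_rev; have [_ _ _] := remove_path_adj adj_z.
  by case: (mid) => //=; rewrite /joins /= eqxx.
Qed.

(** The three parts together are closed under adjacency in T, because no edge
    leaves the interior of the path except along the path. *)
Lemma remove_path_cover (T : mgraph) (v1 : T) (mid : seq T) (vk : T) x
    (R := remove_path v1 mid vk) :
    is_tree T -> shift_path v1 mid vk ->
  [|| connect (@adj R) v1 x, connect (@adj R) vk x | x \in mid].
Proof.
move=> [_ [_ connT] _] shP.
pose U := [pred y | [|| connect (@adj R) v1 y, connect (@adj R) vk y | y \in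
  mid]].
have pU y : y \in v1 :: rcons mid vk -> y \in U.
  rewrite !inE mem_rcons inE => /or3P[/eqP->|/eqP->|->]; rewrite ?orbT //.
    by rewrite connect0.
  by rewrite connect0 orbT.
have clU : closed (@adj T) U.
  apply: (intro_closed (@connect_adj_sym T)) => y z /adjP[e eT eJ] yU.
  have [e_on|e_off] := boolP (on_path (v1 :: rcons mid vk) e).
    by have /andP[] := on_path_ends e_on; case/orP: eJ => /eqP-> /= *;
      apply: pU.
  have e_mid : ~~ ((e.1 \in mid) || (e.2 \in mid)).
    by apply: contra e_off; apply: mid_on_path.
  have yz : connect (@adj R) y z.
    apply/connect1/adjP; exists e => //.
    by rewrite edges_remove_path mem_filter e_off eT andbT -negb_or.
  have y_mid : y \notin mid.
    by move: e_mid; rewrite negb_or; case/orP: eJ => /eqP-> /= /andP[].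
  move: yU; rewrite !inE (negbTE y_mid) orbF => /orP[y_in|y_in].
    by rewrite (connect_trans y_in yz).
  by rewrite (connect_trans y_in yz) orbT.
have v1U : v1 \in U by apply: pU; exact: mem_head.
by move: v1U; rewrite (closed_connect clU (connT v1 x)).
Qed.

(** In a simple graph each step of a path is realised by exactly one edge. *)
Lemma same_path_edges (T : mgraph) (v1 : T) (s : seq T) :
    simple_graph T -> path (@adj T) v1 s -> uniq (v1 :: s) ->
  same_edges [seq e <- edges T | on_path (v1 :: s) e] (path_edges (v1 :: s)).
Proof.
move=> [_ simple] pathP Up; apply/same_edgesP => a b.
have [hit|nhit] := boolP (has (joins a b) (path_edges (v1 :: s))).
  transitivity 1%N; last first.
    by apply/esym/eqP; rewrite eqn_leq count_path_edges // -has_count.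
  rewrite count_filter (eq_count (a2 := joins a b)); last first.
    move=> e /=; apply: andb_idr => eJ.
    by rewrite (on_path_joins _ eJ).
  apply/eqP; rewrite eqn_leq simple -has_count /=.
  case/hasP: hit => d /(path_edgesP pathP)/adjP[e eT eJ] abd.
  apply/hasP; exists e => //; move: eJ abd; case: d e eT => [x y] [z t] _.
  rewrite /joins /= !xpair_eqE; by do !case: eqP => //=; congruence.
transitivity 0%N; last by apply/esym/eqP; rewrite -leqn0 leqNgt -has_count.
apply/eqP; rewrite -leqn0 leqNgt -has_count; apply/hasPn => e.
rewrite mem_filter => /andP[e_on _]; apply: contra nhit => eJ.
by rewrite -(on_path_joins _ eJ).
Qed.

(** * The shifted tree on the vertices of the original tree *)

Lemma edges_component (G : mgraph) (v : G) :
  relabel val (edges (component v)) =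
  [seq e <- edges G | connect (@adj G) v e.1].
Proof.
rewrite /component /=; set F := fun e : G * G => _.
suff gen L : {subset L <= edges G} ->
    relabel val (pmap F L) = [seq e <- L | connect (@adj G) v e.1] by exact:
      gen.
elim: L => //= e L IH sub.
have eE : e \in edges G by apply: sub; rewrite mem_head.
have {}IH : relabel val (pmap F L) = [seq e <- L | connect (@adj G) v e.1].
  by apply: IH => x xL; apply: sub; rewrite inE xL orbT.
have e12 := same_connect_r (@connect_adj_sym G) (connect1 (edge_adj eE)) v.
rewrite /F; case: insubP => [a e1c a_e|/negbTE e1n]; last by rewrite e1n.
case: insubP => [b e2c b_e|/negbTE e2n]; last by rewrite e12 e2n in e1c.
by rewrite e1c /= relabel_cons IH a_e b_e -surjective_pairing.
Qed.

Lemma ident_lift_map (V : finType) (W : Type) (u v : V) (h : V -> W) x :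
  h u = h v -> h (val (ident_map u v x)) = h x.
Proof. by move=> huv /=; case: eqP => [->|]. Qed.

(** A map on the vertices before an identification of u with v becomes
    injective on the representatives if it identifies nothing else. *)
Lemma ident_lift_inj (V : finType) (W : Type) (u v : V) (h : V -> W) :
    (forall x y, h x = h y -> [\/ x = y, x = u /\ y = v | x = v /\ y = u]) ->
  injective (fun x : ident_vert u v => h (val x)).
Proof.
move=> ker x y /ker; have := valP x; have := valP y => /= yP xP xy;
  apply: val_inj => /=.
case: xy yP xP => [//|[-> ->]|[-> ->]].
  by rewrite eqxx => /eqP->.
by move=> _; rewrite eqxx => /eqP->.
Qed.

Lemma edges_identify (G : mgraph) (W : eqType) (u v : G) (h : G -> W) :
  h u = h v ->
  relabel (fun x : identify u v => h (val x)) (edges (identify u v)) =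
  relabel h (edges G).
Proof.
move=> huv; rewrite [edges _]/= -/(relabel _ _) relabel_comp.
by apply: eq_in_relabel => x _ /=; case: eqP => [->|].
Qed.

Lemma edges_disjoint_union (G1 G2 : mgraph) :
  edges (disjoint_union G1 G2) = relabel inl (edges G1) ++ relabel inr (edges
    G2).
Proof. by []. Qed.

Lemma inj_surj_bij (A B : finType) (f : A -> B) :
  injective f -> (forall y, exists x, f x = y) -> bijective f.
Proof.
move=> f_inj f_surj; apply: (inj_card_bij f_inj).
rewrite -(card_codom f_inj); apply/subset_leq_card/subsetP => y _.
by have [x <-] := f_surj y; apply: codom_f.
Qed.

(** The shifted tree is realised on the vertices of T: H1 stays, H2 is moved
    by the transposition of v1 and vk, and the new path runs from vk to v1,
    ending at v1 since the last vertex of the path is the one glued to the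
    trees. *)
Lemma shift_graph_transfer (T : mgraph) (v1 : T) (mid : seq T) (vk : T)
    (R := remove_path v1 mid vk) :
    is_tree T -> shift_path v1 mid vk ->
  exists2 phi : shift_graph v1 mid vk -> T, bijective phi &
    relabel phi (edges (shift_graph v1 mid vk)) =
    [seq e <- edges R | connect (@adj R) v1 e.1] ++
    relabel (tperm v1 vk) [seq e <- edges R | connect (@adj R) vk e.1] ++
    path_edges (rev (v1 :: rcons mid vk)).
Proof.
move=> treeT shP; have sep := remove_path_separates treeT shP.
have [_ Up _] := shP; set p := v1 :: rcons mid vk in Up *.
have [v1_mid vk_mid v1k] : [/\ v1 \notin mid, vk \notin mid & v1 != vk].
  move: Up; rewrite /= mem_rcons inE negb_or rcons_uniq.
  by case/and3P=> /andP[-> ->] -> _.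
have symR := @connect_adj_sym R.
have disj x : connect (@adj R) v1 x -> connect (@adj R) vk x -> False.
  move=> c1; rewrite symR => ck; move/negP: sep; apply.
  exact: connect_trans c1 ck.
have sz_p : size (rev p) = (size mid).+2 by rewrite size_rev /= size_rcons.
pose w1 := @component_root R v1; pose w2 := @component_root R vk.
pose h12 (x : disjoint_union (@component R v1) (@component R vk)) : T :=
  match x with inl a => val a | inr b => tperm v1 vk (val b) end.
have h12_root : h12 (inl w1) = h12 (inr w2) by rewrite /= tpermR.
pose k (x : one_sum w1 w2) : T := h12 (val x).
have tauH2 (b : @component R vk) : val b != vk -> tperm v1 vk (val b) = val b.
  move=> bk; have cb : connect (@adj R) vk (val b) := valP b.
  rewrite tpermD // eq_sym //; apply/eqP => b1.
  by apply: (disj v1 (connect0 _ _)); rewrite -b1.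
have k_inj : injective k.
  apply: ident_lift_inj => -[a|a] [b|b] /=.
  - by move/val_inj->; constructor 1.
  - have [b_vk|bk] := eqVneq (val b) vk.
      rewrite b_vk tpermR => a1; constructor 2.
      by split; congr (_ _); apply: val_inj.
    rewrite tauH2 // => ab; case: (disj (val b)); last exact: (valP b).
    by rewrite -ab; apply: (valP a).
  - have [a_vk|ak] := eqVneq (val a) vk.
      rewrite a_vk tpermR => b1; constructor 3.
      by split; congr (_ _); apply: val_inj.
    rewrite tauH2 // => ab; case: (disj (val a)); last exact: (valP a).
    by rewrite ab; apply: (valP b).
  - by move/perm_inj/val_inj->; constructor 1.
pose hh (x : disjoint_union (one_sum w1 w2) (path_graph (size mid).+1)) : T :=
  match x with inl a => k a | inr i => nth v1 (rev p) i end.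
have nth_max : nth v1 (rev p) (size mid).+1 = v1.
  by rewrite nth_rev /= ?size_rcons // subnn.
have k_root : k (one_sum_root w1 w2) = v1.
  by rewrite /k (ident_lift_map _ h12_root).
have hh_root : hh (inl (one_sum_root w1 w2)) = hh (inr ord_max).
  by rewrite /= k_root nth_max.
have k_off a : k a \in p -> k a = v1.
  have [x ->] : exists x, a = ident_map (inl w1) (inr w2) x by exists (val a);
    apply: val_inj; case: a => a aP /=; case: eqP aP => // -> /=;
      case: eqP => //.
  rewrite /k (ident_lift_map _ h12_root); case: x => [x|x] /=.
    rewrite !inE mem_rcons inE => /or3P[/eqP//|/eqP x_vk|x_mid].
      by have cx : connect (@adj R) v1 (sval x) := valP x;
        rewrite x_vk (negbTE sep) in cx.
    have cx : connect (@adj R) v1 (val x) := valP x.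
    by move: (remove_path_mid v1_mid cx); rewrite x_mid.
  have [->|xk] := eqVneq (val x) vk; first by rewrite tpermR.
  rewrite tauH2 // !inE mem_rcons inE (negbTE xk) => /or3P[/eqP//|//|x_mid].
  have cx : connect (@adj R) vk (val x) := valP x.
  by move: (remove_path_mid vk_mid cx); rewrite x_mid.
pose phi (x : shift_graph v1 mid vk) : T := hh (val x).
have U_rev : uniq (rev p) by rewrite rev_uniq.
have ord_p (i : 'I_(size mid).+2) : (i < size (rev p))%N by rewrite sz_p.
have phi_inj : injective phi.
  have mixed (a : one_sum w1 w2) (i : 'I_(size mid).+2) :
    k a = nth v1 (rev p) i ->
      a = one_sum_root w1 w2 /\ i = ord_max.
    move=> ka; have ka1 : k a = v1 by apply: k_off; rewrite ka -mem_rev mem_nth.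
    split; first by apply: k_inj; rewrite k_root.
    apply: val_inj; apply/eqP; rewrite -(nth_uniq v1 _ _ U_rev) ?sz_p //=.
    by rewrite nth_max -ka ka1.
  apply: ident_lift_inj => -[a|i] [b|j] /=.
  - by move/k_inj->; constructor 1.
  - by case/mixed=> -> ->; constructor 2.
  - by move/esym/mixed=> [-> ->]; constructor 3.
  - move/eqP; rewrite nth_uniq // => /eqP/val_inj->; by constructor 1.
have phi_surj y : exists x, phi x = y.
  have hh_phi x : exists x', phi x' = hh x.
    by exists (ident_map (inl (one_sum_root w1 w2)) (inr ord_max) x);
      apply: ident_lift_map.
  have k_phi x : exists x', phi x' = h12 x.
    have [x' phi_x'] := hh_phi (inl (ident_map (inl w1) (inr w2) x)).
    by exists x'; rewrite phi_x'; apply: ident_lift_map.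
  have p_phi : y \in p -> exists x, phi x = y.
    rewrite -mem_rev => yp; have yi : (index y (rev p) < (size mid).+2)%N.
      by rewrite -sz_p index_mem.
    have [x phi_x] := hh_phi (inr (Ordinal yi)).
    by exists x; rewrite phi_x /= nth_index.
  have [/p_phi//|yp] := boolP (y \in p).
  have := remove_path_cover y treeT shP => /or3P[y1|yk|y_mid].
  - by have [x phi_x] := k_phi (inl (exist _ y y1)); exists x.
  - have [x phi_x] := k_phi (inr (exist _ y yk)); exists x;
    rewrite phi_x [LHS]tauH2 //=.
    by apply: contraNneq yp => ->; rewrite inE mem_rcons mem_head orbT.
  - by case/negP: yp; rewrite inE mem_rcons inE y_mid !orbT.
exists phi; first exact: inj_surj_bij.
rewrite [LHS](edges_identify (h := hh) hh_root) edges_disjoint_union.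
rewrite relabel_cat catA; congr (_ ++ _).
  rewrite (relabel_comp hh inl) [LHS](edges_identify (h := h12) h12_root)
    edges_disjoint_union.
  rewrite relabel_cat !relabel_comp -(@edges_component R v1) -(@edges_component
    R vk).
  by rewrite relabel_comp.
rewrite relabel_comp.
have -> : rev p = vk :: rev (v1 :: mid) by rewrite /p -rcons_cons rev_rcons.
rewrite (path_edges_nth v1) size_rev /relabel -map_comp; apply/eq_in_map => i.
rewrite mem_iota add0n => /andP[_ lt_i] /=.
by rewrite /p -rcons_cons rev_rcons !inordK // ltnW.
Qed.

(** Splits the edges of T into the path and the two components; the cones over
    T and its shift then have the form compared in [rank_cone_shift]. *)
Lemma f_poly_shift (T S : mgraph) :
  tree_shift T S -> forall i, 0 <= (f_poly T - f_poly S)`_i.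
Proof.
case=> treeT [v1 [mid [vk [shP isoS]]]] i.
have [phi phi_bij phiE] := shift_graph_transfer treeT shP.
pose R := remove_path v1 mid vk; pose p := v1 :: rcons mid vk.
pose E1 := [seq e <- edges R | connect (@adj R) v1 e.1].
pose E2 := [seq e <- edges R | connect (@adj R) vk e.1].
have [pathP Up _] := shP; have [simpleT _ _] := treeT.
have sep : ~~ connect (@adj R) v1 vk := remove_path_separates treeT shP.
have symR := @connect_adj_sym R.
have disj x : connect (@adj R) v1 x -> ~~ connect (@adj R) vk x.
  move=> c1; apply: contra sep; rewrite symR => xk.
  exact: connect_trans c1 xk.
have [v1_mid vk_mid] : v1 \notin mid /\ vk \notin mid.
  move: Up; rewrite /= mem_rcons inE negb_or rcons_uniq.
  by case/and3P=> /andP[_ ->] ->.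
have edge_R e : e \in edges R -> [/\ e.1 \notin mid, e.2 \notin mid &
    connect (@adj R) e.1 e.2].
  move=> eR; split; last exact/connect1/edge_adj.
    by move: eR; rewrite edges_remove_path mem_filter => /andP[/and3P[]].
  by move: eR; rewrite edges_remove_path mem_filter => /andP[/and3P[]].
have fS : f_poly S =
    (rank_poly (cone_edges (E1 ++ relabel (tperm v1 vk) E2 ++ path_edges
      p)))`_#|T|.
  rewrite (f_poly_iso isoS); apply: (f_poly_transfer phi_bij).
  by rewrite phiE; do 2!apply: same_cat (same_refl _) _; apply: path_edges_rev.
have fT : f_poly T = (rank_poly (cone_edges (E1 ++ E2 ++ path_edges p)))`_#|T|.
  apply: (@f_poly_transfer T T id); first by exists id.
  rewrite relabel_id_in //.
  have offR : edges R = [seq e <- edges T | ~~ on_path p e].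
    apply/eq_in_filter => e eT /=; rewrite -negb_or.
    by apply: andb_idr; apply: contra; apply: mid_on_path.
  have E2E : E2 = [seq e <- edges R | ~~ connect (@adj R) v1 e.1].
    apply/eq_in_filter => e /edge_R[e1 _ _].
    have := remove_path_cover e.1 treeT shP; rewrite (negbTE e1) orbF -/R.
    by have [/disj/negbTE->|] := boolP (connect _ v1 _).
  have splitR : perm_eq (E1 ++ E2) (edges R) by rewrite E2E perm_filterC.
  have split_on : perm_eq ([seq e <- edges T | on_path p e] ++ edges R) (edges
    T).
    by rewrite offR perm_filterC.
  rewrite same_sym; apply: same_trans (perm_same split_on).
  apply: (@same_trans _ (path_edges p ++ (E1 ++ E2))).
    by apply: perm_same; rewrite perm_sym perm_catC -catA.
  by apply: same_cat; rewrite same_sym ?same_path_edges //; apply: perm_same;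
    rewrite perm_sym.
have endsE v : {subset ends [seq e <- edges R | connect (@adj R) v e.1] <=
    v |: ([set x | connect (@adj R) v x] :\ v)}.
  apply/endsP => e; rewrite mem_filter => /andP[ve /edge_R[_ _ e12]].
  rewrite !inE ve (connect_trans ve e12) !andbT.
  by rewrite !orbN.
rewrite fT fS -coefB; apply: (rank_cone_shift Up (endsE v1) (endsE vk)).
- apply/pred0P => x; rewrite !inE; apply/negP => /andP[/andP[_ /disj xk]].
  by rewrite (negbTE xk) andbF.
- move=> x; rewrite !inE mem_rcons inE => /or3P[/eqP->|/eqP->|x_mid].
  + by rewrite eqxx (negbTE (disj _ (connect0 _ _))) andbF.
  + by rewrite eqxx (negbTE sep) andbF.
  have mid_off v : v \notin mid -> ~~ connect (@adj R) v x.
    by move=> v_mid; apply: contraL x_mid => /(remove_path_mid v_mid).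
  by rewrite !(negbTE (mid_off _ _)) ?andbF.
move=> x; rewrite !inE mem_rcons inE.
have := remove_path_cover x treeT shP => /or3P[c1|ck|->].
- by rewrite -/R c1; case: eqP => //=; rewrite ?orbT.
- by rewrite -/R ck; case: (x == vk); rewrite ?orbT.
- by rewrite !orbT.
Qed.

Theorem corollary3p3 (n : nat) (T T' : mgraph) (hn : (3 <= n)%N)
    (hT : is_tree T) (hT' : is_tree T')
    (cardT : #|T| = n) (cardT' : #|T'| = n) (hlt : csikvari_lt T T') :
  forall i : nat, 0 <= (f_poly T - f_poly T')`_i.
Proof.
case: hlt => le_TT' _ i; elim: le_TT' =>
  {T T' hT hT' cardT cardT'} [T T' /f_poly_iso->|T S T' shift _ IH].
  by rewrite subrr coef0.
have -> : f_poly T - f_poly T' = (f_poly T - f_poly S) + (f_poly S - f_poly T')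
  by rewrite addrA subrK.
by rewrite coefD addr_ge0 // f_poly_shift.
Qed.
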